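(* Let $X=[x_1,\dots,x_n]^T$ be a random vector in $\mathbb{R}^n$ with i.i.d. entries satisfying $\mathbb{E}x_1=0$, $\mathbb{E}x_1^2=1$, $\mathbb{E}x_1^4=1+\sigma^2$ with $0\le\sigma<\infty$. Let $S$ be an $m\times n$ random matrix (viewed as a map $\mathbb{R}^n\to\mathbb{R}^m$) with i.i.d. entries $S_{i,j}$ satisfying $\mathbb{E}S_{i,j}=0$, $\mathbb{E}S_{i,j}^2=1$ and $\mathbb{E}S_{1,1}^4<c<\infty$ for some constant $c$. Assume $S$ and $X$ are independent. Let $\xi=(\mathbb{E}S_{1,1}^4-1)\mathbb{E}x_1^4-2$ and define \[ A(m,n)=\frac{\|SX\|^2-mn}{\sqrt{\sigma^2m^2n+2mn^2+\xi mn}}. \] If $m,n\to\infty$ with $\frac{m}{n}\to 0$, then $A(m,n)$ converges in distribution to the standard normal distribution $\mathcal{N}(0,1)$.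
   Context: $\|\cdot\|$ denotes the Euclidean norm, so $\|SX\|^2=X^TS^TSX$. *)

(* Defs.v *)
From HB Require Import structures.
From mathcomp Require Import all_boot all_order all_algebra.
From mathcomp Require Import finmap.
From mathcomp Require Import all_classical all_reals all_analysis.
Set Implicit Arguments. Unset Strict Implicit. Unset Printing Implicit Defensive.
Import Order.TTheory GRing.Theory Num.Theory.
Import numFieldNormedType.Exports.
Local Open Scope classical_set_scope.
Local Open Scope ring_scope.

Definition mutually_independent {d} {T : measurableType d} {R : realType}
    (P : probability T R) {I : choiceType} (Y : I -> T -> R) : Prop :=
  forall (J : {fset I}) (B : I -> set R), (forall i, measurable (B i)) ->
    P (\bigcap_(i in [set` J]) (Y i @^-1` B i)) =
    (\prod_(i <- J) P (Y i @^-1` B i))%E.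

Definition joint_family {T R : Type} (x : nat -> T -> R)
    (s : nat -> nat -> T -> R) : nat + (nat * nat) -> T -> R :=
  fun i => match i with inl j => x j | inr ab => s ab.1 ab.2 end.

Definition SX_normsq {T : Type} {R : realType} (x : nat -> T -> R)
    (s : nat -> nat -> T -> R) (m n : nat) (w : T) : R :=
  let S := \matrix_(i < m, j < n) s i j w in
  let X := \col_(j < n) x j w in
  \sum_(i < m) ((S *m X) i ord0) ^+ 2.

Definition Amn {T : Type} {R : realType} (x : nat -> T -> R)
    (s : nat -> nat -> T -> R) (sigma xi : R) (m n : nat) (w : T) : R :=
  (SX_normsq x s m n w - (m * n)%:R) /
  Num.sqrt (sigma ^+ 2 * (m ^ 2 * n)%:R + 2 * (m * n ^ 2)%:R
            + xi * (m * n)%:R).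

(* Main.v *)
(** Write [q_i] for the sum of [S_ij S_ik x_j x_k] over [j < k].  Then
    [|SX|^2 - mn] equals [2 (q_1 + ... + q_m)] plus the two terms
    [sum_ij (S_ij^2 - 1) x_j^2] and [m sum_j (x_j^2 - 1)], whose variances
    [O(mn)] and [O(m^2 n)] are negligible against [2 m n^2] when [m / n -> 0].
    Let [W] be the sum of the [q_i], scaled to have asymptotic variance [1].
    Every monomial of [q_i^4] has degree at most [4] in each entry, so
    [E q_i^4 = O(n^4)], although [E (SX)_i^8] need not be finite.

    The normal limit of [W] comes from Stein's method.  For a Lipschitz test
    function [h] with Gaussian mean [Nh], the bounded solution of
    [f' - y f = h - Nh] has a bounded and locally Lipschitz derivative.  Let
    [W_i] be [W] without its [i]-th row: conditionally on [X] and the other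
    rows, the scaled [q_i] has mean [0] and a variance that depends on [X] only
    and is close to [1 / m], and expanding [f (W)] around [W_i] gives
    [E (f' (W) - W f (W)) -> 0].  Piecewise linear [h] then squeeze the
    distribution function. *)

Require Import Defs.
From HB Require Import structures.
From mathcomp Require Import all_boot all_order all_algebra.
From mathcomp Require Import finmap.
From mathcomp Require Import all_classical all_reals all_analysis.
From mathcomp Require Import measurable_realfun.
From mathcomp Require Import ring lra.
Import Order.TTheory GRing.Theory Num.Theory.
Import numFieldNormedType.Exports.
Local Open Scope classical_set_scope.
Local Open Scope ring_scope.
Set Implicit Arguments. Unset Strict Implicit. Unset Printing Implicit Defensive.

(** Two facts shape the argument: the rows are independent only given [X], and only four moments of
    the entries are available. Conditional expectations are never constructed. A conditional mean or
    variance given everything but row [i] is tested against a function [g] free of that row, and the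
    entries of the row are integrated out one by one, each being independent of the sigma-algebra of
    all the others. With the pairs [j < k] grouped by [k], each increment of [q_i] carries one fresh
    factor [S_ik]. A Burkholder inequality, used for the inner sums, for the outer sum and for the
    sum over rows, then gives every fourth moment. In the Stein remainder, [W_i] and [q_i] are
    dependent through [X], so mixed expectations do not factor; a weighted AM-GM splits them into
    separate fourth moments, at the price of a free weight [eta]. Up to constants and the ratio of
    the two normalisations, the errors are of the form [eta + tau / eta] with
    [tau = 1/m + 1/n + m/n], which suggests [eta = sqrt tau]. *)

Section integrability.
Context {d : measure_display} {T : measurableType d} {R : realType}.
Variable P : probability T R.

Lemma integrable_le_norm (f g : T -> R) : measurable_fun setT f ->
  P.-integrable setT (EFin \o g) -> (forall w, `|f w| <= g w) ->
  P.-integrable setT (EFin \o f).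
Proof.
move=> mf ig fg; apply: (le_integrable measurableT _ _ ig).
  exact/measurable_EFinP.
move=> w _ /=; rewrite lee_fin; apply: (le_trans (fg w)); exact: ler_norm.
Qed.

Lemma integrable_real_cst (k : R) : P.-integrable setT (EFin \o (fun=> k)).
Proof. exact: finite_measure_integrable_cst. Qed.

Lemma Rintegral_prob_cst (k : R) : \int[P]_w k = k.
Proof.
rewrite /Rintegral integral_cst//.
by have /= -> := @probability_setT _ _ _ P; rewrite mule1.
Qed.

Lemma integrable_realD (f g : T -> R) : P.-integrable setT (EFin \o f) ->
  P.-integrable setT (EFin \o g) ->
  P.-integrable setT (EFin \o (fun w => f w + g w)).
Proof. by move=> i1 i2; exact: (integrableD measurableT i1 i2). Qed.

Lemma integrable_realZ (k : R) (f : T -> R) : P.-integrable setT (EFin \o f) ->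
  P.-integrable setT (EFin \o (fun w => k * f w)).
Proof. by move=> i1; exact: (integrableZl measurableT k i1). Qed.

Lemma integrable_realB (f g : T -> R) : P.-integrable setT (EFin \o f) ->
  P.-integrable setT (EFin \o g) ->
  P.-integrable setT (EFin \o (fun w => f w - g w)).
Proof. by move=> i1 i2; exact: (integrableB measurableT i1 i2). Qed.

Lemma integrable_real_sum (I : Type) (r : seq I) (p : pred I) (f : I -> T -> R) :
  (forall i, p i -> P.-integrable setT (EFin \o f i)) ->
  P.-integrable setT (EFin \o (fun w => \sum_(i <- r | p i) f i w)).
Proof.
move=> fi; rewrite (_ : _ \o _ = fun w => (\sum_(i <- r | p i) (f i w)%:E)%E).
  exact: integrable_sum.
by apply/funext => w /=; rewrite sumEFin.
Qed.

Lemma measurable_integrable (f : T -> R) :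
  P.-integrable setT (EFin \o f) -> measurable_fun setT f.
Proof. by move/measurable_int/measurable_EFinP. Qed.

Lemma Rintegral_sum (I : Type) (r : seq I) (p : pred I) (f : I -> T -> R) :
  (forall i, p i -> P.-integrable setT (EFin \o f i)) ->
  \int[P]_w (\sum_(i <- r | p i) f i w) = \sum_(i <- r | p i) \int[P]_w f i w.
Proof.
move=> fi; elim: r => [|i r ih].
  rewrite big_nil; under eq_Rintegral do rewrite big_nil.
  by rewrite Rintegral_cst// mul0r.
rewrite big_cons; under eq_Rintegral do rewrite big_cons.
case: ifPn => pi //; rewrite RintegralD// ?ih//; first exact: fi.
exact: integrable_real_sum.
Qed.

Lemma integrable_mulr_bounded (f g : T -> R) (K : R) :
  P.-integrable setT (EFin \o f) -> measurable_fun setT g ->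
  (forall w, `|g w| <= K) -> P.-integrable setT (EFin \o (fun w => f w * g w)).
Proof.
move=> fi mg gK; apply: (@integrable_le_norm _ (fun w => K * `|f w|)).
- by apply: measurable_funM => //; exact: measurable_integrable.
- by apply: integrable_realZ; exact: integrable_norm.
- by move=> w; rewrite normrM mulrC ler_wpM2r.
Qed.

Lemma Rintegral_norm_le (f g : T -> R) :
  P.-integrable setT (EFin \o f) -> P.-integrable setT (EFin \o g) ->
  (forall w, `|f w| <= g w) -> `|\int[P]_w f w| <= \int[P]_w g w.
Proof.
move=> fi gi fg; apply: (le_trans (le_normr_Rintegral measurableT fi)).
by apply: le_Rintegral => //; exact: integrable_norm.
Qed.

End integrability.

(** * Independence of one coordinate from functions of all the others *)

Section independence.
Context {d : measure_display} {T : measurableType d} {R : realType}.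
Variable P : probability T R.

(** The law of [(U, V)] agrees with the product of the marginals on rectangles, hence everywhere.
    Tonelli then gives integrability and Fubini the factorisation. *)
Lemma Rintegral_indepM (U V : {RV P >-> R}) :
  (forall A B, measurable A -> measurable B ->
     P (U @^-1` A `&` V @^-1` B) = (P (U @^-1` A) * P (V @^-1` B))%E) ->
  P.-integrable setT (EFin \o U) -> P.-integrable setT (EFin \o V) ->
  P.-integrable setT (EFin \o (fun w => U w * V w)) /\
  \int[P]_w (U w * V w) = (\int[P]_w U w) * (\int[P]_w V w).
Proof.
move=> indep iU iV.
have mUV : measurable_fun setT (fun w => (U w, V w)).
  exact: measurable_fun_pair.
pose UV : {RV P >-> (R * R)%type} :=
  HB.pack (fun w => (U w, V w)) (isMeasurableFun.Build _ _ _ _ _ mUV).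
pose m1 := distribution P U; pose m2 := distribution P V.
have prodE A : measurable A -> (m1 \x m2)%E A = distribution P UV A.
  move=> mA; apply: product_measure_unique => // B C mB mC; exact: indep.
have mf : measurable_fun setT (fun z : R * R => (z.1 * z.2)%:E).
  by apply/measurable_EFinP; exact: measurable_funM.
have mUVf : measurable_fun setT (EFin \o (fun w => U w * V w)).
  by apply/measurable_EFinP; exact: measurable_funM.
have absfin (W : {RV P >-> R}) : P.-integrable setT (EFin \o W) ->
    (\int[distribution P W]_u `|u%:E| < +oo)%E.
  move=> /integrableP[_]; rewrite ge0_integral_distribution//.
  exact: measurableT_comp.
have mabs : measurable_fun setT (fun v : R => `|v|%:E).
  by apply/measurable_EFinP; exact: normr_measurable.
have iUV : (m1 \x m2)%E.-integrable setT (fun z => (z.1 * z.2)%:E).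
  apply/integrable12ltyP => //.
  pose c := fine (\int[m2]_v `|v%:E|)%E.
  have cE : (\int[m2]_v `|v%:E|)%E = c%:E.
    by rewrite fineK// ge0_fin_numE ?absfin//; exact: integral_ge0.
  have c0 : 0 <= c by rewrite fine_ge0//; exact: integral_ge0.
  have inE u : (\int[m2]_v `|(u * v)%:E| = c%:E * `|u|%:E)%E.
    under eq_integral do rewrite EFinM abseM.
    by rewrite ge0_integralZl// cE muleC.
  under eq_integral do rewrite inE.
  by rewrite ge0_integralZl ?lee_fin// lte_mul_pinfty ?lee_fin// absfin.
have iP : P.-integrable setT (EFin \o (fun w => U w * V w)).
  apply/integrableP; split => //.
  move/integrableP : iUV => [_].
  rewrite (eq_measure_integral (distribution P UV)); last first.
    by move=> ? ? _; exact: prodE.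
  by rewrite ge0_integral_distribution//; exact: measurableT_comp.
split=> //.
have intE : (\int[P]_w (U w * V w)%:E =
    \int[m1]_u \int[m2]_v (u * v)%:E)%E.
  rewrite (integral12_prod_meas1 iUV).
  rewrite (eq_measure_integral (distribution P UV)); last first.
    by move=> ? ? _; exact: prodE.
  by rewrite integral_distribution.
have mE (W : {RV P >-> R}) : P.-integrable setT (EFin \o W) ->
    (distribution P W).-integrable setT EFin.
  move=> iW; apply: integrable_pushforward => //.
have intdE (W : {RV P >-> R}) : P.-integrable setT (EFin \o W) ->
    (\int[distribution P W]_u u%:E = (\int[P]_w W w)%:E)%E.
  move=> iW; rewrite integral_distribution// /Rintegral fineK//.
  exact: integrable_fin_num.
rewrite [LHS]/Rintegral intE.
have inE u : (\int[m2]_v (u * v)%:E = (\int[P]_w V w)%:E * u%:E)%E.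
  under eq_integral do rewrite EFinM.
  rewrite integralZl//; last exact: mE.
  by rewrite intdE// muleC.
under eq_integral do rewrite inE.
rewrite integralZl//; last exact: mE.
by rewrite intdE//= mulrC.
Qed.

Context {I : choiceType}.
Variable Z : I -> {RV P >-> R}.

(** A generating pi-system on which mutual independence evaluates [P] directly. *)
Definition cylinders_avoiding (i : I) : set (set T) :=
  [set A | exists J : {fset I}, exists B : I -> set R,
    [/\ i \notin J, forall j, measurable (B j) &
        A = \bigcap_(j in [set` J]) (Z j @^-1` B j)]].

(* [G] is a measurable function of the coordinates of [Z] other than [i]. *)
Definition avoids (i : I) (G : T -> R) : Prop :=
  @measurable_fun _ _ (g_sigma_algebraType (cylinders_avoiding i)) R setT G.

Lemma cylinders_avoiding_setI i : setI_closed (cylinders_avoiding i).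
Proof.
move=> _ _ [J [B [iJ mB ->]]] [K [C [iK mC ->]]].
exists (J `|` K)%fset.
exists (fun j => (if j \in J then B j else setT) `&`
                 (if j \in K then C j else setT)); split.
- by rewrite inE negb_or iJ iK.
- by move=> j; apply: measurableI; case: ifP.
apply/seteqP; split=> [w [wB wC] j /=|w wBC].
  rewrite inE => jJK; split; case: ifPn => // h; first exact: wB.
  exact: wC.
split=> j /= jJ.
  by have := wBC j; rewrite /= inE jJ /= => /(_ isT)[].
by have := wBC j; rewrite /= inE jJ orbT /= => /(_ isT)[].
Qed.

Lemma cylinders_avoiding_measurable i :
  cylinders_avoiding i `<=` measurable.
Proof.
move=> _ [J [B [_ mB ->]]].
apply: fin_bigcap_measurable => // j _.
by rewrite -[X in measurable X]setTI; exact: measurable_funP.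
Qed.

Lemma avoids_measurable i G : avoids i G -> measurable_fun setT G.
Proof.
move=> mG _ B mB; have := mG measurableT B mB.
rewrite /= /measurable /=; apply: smallest_sub.
  exact: sigma_algebra_measurable.
exact: cylinders_avoiding_measurable.
Qed.

Lemma avoids_coord i j : i != j -> avoids i (Z j).
Proof.
move=> ij _ B mB; rewrite setTI; apply: sub_sigma_algebra.
exists [fset j]%fset, (fun=> B); split => //; first by rewrite inE.
apply/seteqP; split => [w wB k|w wB] /=; last by apply: wB; rewrite /= inE.
by rewrite inE => /eqP ->.
Qed.

Hypothesis indepZ : mutually_independent P (fun i => Z i : T -> R).

(** Uniqueness of measures: [P] restricted to the event on [Z i], and [P] scaled by the probability
    of that event, agree on the pi-system of cylinders and hence on the sigma-algebra it
    generates. *)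
Lemma avoids_indep i A B : measurable A ->
  <<s cylinders_avoiding i >> B ->
  P (Z i @^-1` A `&` B) = (P (Z i @^-1` A) * P B)%E.
Proof.
move=> mA sB.
have mZA : measurable (Z i @^-1` A).
  by rewrite -[X in measurable X]setTI; exact: measurable_funP.
pose a : {nonneg R} := NngNum (fine_ge0 (measure_ge0 P (Z i @^-1` A))).
have aE : (a%:num)%:E = P (Z i @^-1` A).
  by rewrite /= fineK//; exact: fin_num_measure.
rewrite setIC -aE.
apply: (g_sigma_algebra_measure_unique (cylinders_avoiding i)
  (@cylinders_avoiding_measurable i) (fun=> setT) _ _
  (mrestr P mZA) (mscale a P) (@cylinders_avoiding_setI i)) => //.
- move=> _; exists fset0, (fun=> setT); split=> //.
  by apply/seteqP; split=> // w _ j; rewrite /= inE.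
- by apply: bigcup_const; exists 0%N.
- move=> _ [J [C [iJ mC ->]]].
  rewrite -[RHS]/((a%:num)%:E * P _)%E aE -[LHS]/(P (_ `&` _)).
  have JE j : j \in J -> (if j == i then A else C j) = C j.
    by move=> jJ; case: eqP => // ji; rewrite -ji jJ in iJ.
  have mD j : measurable (if j == i then A else C j) by case: ifP.
  have := indepZ (i |` J)%fset mD.
  rewrite big_fsetU1//= eqxx => /= PE.
  have := indepZ J mC => PC.
  rewrite PC.
  transitivity (P (\bigcap_(j in [set` (i |` J)%fset])
                     Z j @^-1` (if j == i then A else C j))).
    congr (P _); apply/seteqP; split.
      move=> w [wC wA] j /=; rewrite !inE; case: eqP => [->//|_ /= jJ].
      exact: wC.
    move=> w wC; split; last first.
      by have := wC i; rewrite /= !inE eqxx; apply.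
    by move=> j jJ; have := wC j; rewrite /= !inE jJ orbT => /(_ isT); rewrite JE.
  rewrite PE; congr (_ * _)%E; apply: eq_big_seq => j jJ.
  by rewrite JE.
- move=> _; rewrite /mrestr /=.
  apply: (le_lt_trans (probability_le1 _ _)); last exact: ltry.
  exact: measurableI.
Qed.

(** Integrating out one coordinate: this stands in for conditioning on all the others. Integrability
    of the product is part of the conclusion because later computations integrate out several
    coordinates in turn. *)
Lemma Rintegral_avoidsM i (g : R -> R) (G : T -> R) :
  measurable_fun setT g -> avoids i G ->
  P.-integrable setT (EFin \o (fun w => g (Z i w))) ->
  P.-integrable setT (EFin \o G) ->
  P.-integrable setT (EFin \o (fun w => g (Z i w) * G w)) /\
  \int[P]_w (g (Z i w) * G w) = (\int[P]_w g (Z i w)) * (\int[P]_w G w).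
Proof.
move=> mg aG ig iG.
have mgZ : measurable_fun setT (fun w => g (Z i w)).
  by apply: measurableT_comp.
pose U : {RV P >-> R} := HB.pack (fun w => g (Z i w))
  (isMeasurableFun.Build _ _ _ _ _ mgZ).
pose V : {RV P >-> R} := HB.pack G
  (isMeasurableFun.Build _ _ _ _ _ (avoids_measurable aG)).
apply: (@Rintegral_indepM U V) => // A B mA mB.
rewrite (_ : U @^-1` A = Z i @^-1` (g @^-1` A))//.
apply: avoids_indep.
  by rewrite -[X in measurable X]setTI; exact: mg.
by have := aG measurableT B mB; rewrite setTI.
Qed.

End independence.

(** * Fourth moments, and sums of martingale differences *)

Section moments.
Context {d : measure_display} {T : measurableType d} {R : realType}.
Variable P : probability T R.

(** Stable under linear combinations but not under products; a product of four such variables is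
    integrable, so degree four is the ceiling in what follows. *)
Definition fourth_integrable (V : T -> R) : Prop :=
  measurable_fun setT V /\ P.-integrable setT (EFin \o (fun w => V w ^+ 4)).

Local Notation L4 := fourth_integrable.

Lemma fourth_integrable_bound (V : T -> R) (g : T -> R) :
  measurable_fun setT V -> P.-integrable setT (EFin \o g) ->
  (forall w, V w ^+ 4 <= g w) -> L4 V.
Proof.
move=> mV ig Vg; split=> //.
apply: (integrable_le_norm _ ig); first exact: measurable_funX.
move=> w; rewrite ger0_norm//; exact: (exprn_even_ge0 _ (isT : ~~ odd 4)).
Qed.

Lemma fourth_integrable_cst (k : R) : L4 (fun=> k).
Proof.
split; first exact: measurable_cst.
exact: (integrable_real_cst P (k ^+ 4)).
Qed.

Lemma fourth_integrableZ (k : R) V : L4 V -> L4 (fun w => k * V w).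
Proof.
move=> [mV iV]; apply: (@fourth_integrable_bound _ (fun w => k ^+ 4 * V w ^+ 4)).
- by apply: measurable_funM => //; exact: measurable_cst.
- exact: integrable_realZ.
- by move=> w; rewrite exprMn.
Qed.

Lemma fourth_integrableD V U : L4 V -> L4 U -> L4 (fun w => V w + U w).
Proof.
move=> [mV iV] [mU iU].
apply: (@fourth_integrable_bound _ (fun w => 8 * (V w ^+ 4 + U w ^+ 4))).
- exact: measurable_funD.
- by apply: integrable_realZ; exact: integrable_realD.
- move=> w; set a := V w; set b := U w.
  (* Convexity of the fourth power, with constant [2 ^ 3 = 8]. The second factor of the gap is a
     nonnegative quadratic form. *)
  rewrite -subr_ge0 (_ : _ - _ = (a - b) ^+ 2 * (7 * (a ^+ 2 + b ^+ 2) +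
    10 * (a * b))); last by ring.
  apply: mulr_ge0; first exact: sqr_ge0.
  have := sqr_ge0 (a + b); have := sqr_ge0 a; have := sqr_ge0 b.
  rewrite !expr2; nra.
Qed.

Lemma fourth_integrableB V U : L4 V -> L4 U -> L4 (fun w => V w - U w).
Proof.
move=> V4 U4; rewrite (_ : (fun w => _) = fun w => V w + (-1) * U w).
  by apply: fourth_integrableD => //; exact: fourth_integrableZ.
by apply/funext => w; rewrite mulN1r.
Qed.

Lemma fourth_integrable_sum (I : Type) (r : seq I) (p : pred I) (V : I -> T -> R) :
  (forall i, p i -> L4 (V i)) -> L4 (fun w => \sum_(i <- r | p i) V i w).
Proof.
move=> V4; elim: r => [|i r ih].
  under eq_fun do rewrite big_nil; exact: fourth_integrable_cst.
under eq_fun do rewrite big_cons.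
by case: (boolP (p i)) => // pi; apply: fourth_integrableD => //; exact: V4.
Qed.

Lemma normM4_le (a b c e : R) :
  `|a * b * c * e| <= a ^+ 4 + b ^+ 4 + c ^+ 4 + e ^+ 4.
Proof.
have h (u v : R) : `|u * v| <= u ^+ 2 + v ^+ 2.
  have := sqr_ge0 (u - v); have := sqr_ge0 (u + v).
  rewrite !expr2 => h1 h2; rewrite ler_norml; apply/andP; split; nra.
rewrite -mulrA; apply: (le_trans (h _ _)).
rewrite !exprMn.
have k (u v : R) : u ^+ 2 * v ^+ 2 <= u ^+ 4 + v ^+ 4.
  have := h (u ^+ 2) (v ^+ 2); rewrite -!exprM /=; apply: le_trans.
  exact: ler_norm.
by rewrite -addrA; apply: lerD; exact: k.
Qed.

Lemma integrable_fourM V1 V2 V3 V4 : L4 V1 -> L4 V2 -> L4 V3 -> L4 V4 ->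
  P.-integrable setT (EFin \o (fun w => V1 w * V2 w * V3 w * V4 w)).
Proof.
move=> [m1 i1] [m2 i2] [m3 i3] [m4 i4].
apply: (@integrable_le_norm _ _ _ _ _
  (fun w => V1 w ^+ 4 + V2 w ^+ 4 + V3 w ^+ 4 + V4 w ^+ 4)).
- by do 3 apply: measurable_funM => //.
- by do 3 apply: integrable_realD => //.
- by move=> w; exact: normM4_le.
Qed.

Lemma integrable_twoM V U : L4 V -> L4 U ->
  P.-integrable setT (EFin \o (fun w => V w * U w)).
Proof.
move=> V4 U4.
have := integrable_fourM V4 U4 (fourth_integrable_cst 1) (fourth_integrable_cst 1).
by under eq_fun do rewrite !mulr1.
Qed.

Lemma fourth_integrable_integrable V : L4 V -> P.-integrable setT (EFin \o V).
Proof.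
move=> V4; have := integrable_twoM V4 (fourth_integrable_cst 1).
by under eq_fun do rewrite mulr1.
Qed.

Lemma fourth_integrable_sqr V : L4 V ->
  P.-integrable setT (EFin \o (fun w => V w ^+ 2)).
Proof.
by move=> V4; have := integrable_twoM V4 V4; under eq_fun do rewrite -expr2.
Qed.

(* Burkholder's inequality for the fourth moment; the last hypothesis is all
   that the proof needs of the martingale property of the partial sums. *)
Lemma fourth_moment_sum (D : nat -> T -> R) (K : R) (n : nat) :
  (forall i, (i < n)%N -> L4 (D i)) ->
  (forall i, (i < n)%N -> \int[P]_w (D i w ^+ 4) <= K) ->
  (forall i, (i < n)%N -> \int[P]_w (D i w * (\sum_(j < i) D j w) ^+ 3) = 0) ->
  \int[P]_w ((\sum_(i < n) D i w) ^+ 4) <= 70 * K * n%:R ^+ 2.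
Proof.
move=> D4 DK D0.
have S4 i : (i <= n)%N -> L4 (fun w => \sum_(j < i) D j w).
  move=> ile; apply: fourth_integrable_sum => j _; apply: D4.
  exact: leq_trans (ltn_ord j) ile.
(* The bound is made linear in [i] with slope [70 * K * n]. One step costs [35 * K * i] from the
   growth factor [c] and [(3 + 32 * n) * K] from the new term, and [35 + 3 + 32 = 70]. *)
suff h i : (i <= n)%N ->
    \int[P]_w ((\sum_(j < i) D j w) ^+ 4) <= 70 * K * n%:R * i%:R.
  by apply: (le_trans (h n (leqnn n))); rewrite expr2 mulrA.
elim: i => [_|i ih ilt].
  rewrite mulr0; under eq_Rintegral do rewrite big_ord0 expr0n.
  by rewrite Rintegral_cst// mul0r.
have n0 : 0 < n%:R :> R by rewrite ltr0n; exact: leq_ltn_trans ilt.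
have {}ih := ih (ltnW ilt).
set S := fun w => \sum_(j < i) D j w in ih.
have [mS iS] : L4 S by apply: S4; exact: ltnW.
have [mD iD] := D4 i ilt.
have i13 : P.-integrable setT (EFin \o (fun w => D i w * S w ^+ 3)).
  rewrite (_ : (fun w => _) = fun w => D i w * S w * S w * S w).
    by apply: integrable_fourM => //; exact: D4.
  by apply/funext => w; ring.
(* In the expansion of [(S + D) ^ 4] the term [4 D S^3] is kept exactly, since its mean is [0]. The
   terms [6 S^2 D^2] and [4 S D^3] are absorbed into [S^4 / (2 n)] and a multiple of [D^4]; the
   factor [c] is harmless over [n] steps. *)
pose c := 1 + (2 * n%:R)^-1 : R.
pose G w := c * S w ^+ 4 + 4 * (D i w * S w ^+ 3) +
  (3 + 32 * n%:R) * D i w ^+ 4.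
have iG : P.-integrable setT (EFin \o G).
  by apply: integrable_realD; [apply: integrable_realD|]; exact: integrable_realZ.
have le1 : \int[P]_w ((\sum_(j < i.+1) D j w) ^+ 4) <= \int[P]_w G w.
  apply: le_Rintegral => //; first by case: (S4 _ ilt).
  move=> w _; rewrite big_ord_recr /= -/(S w) /G /c.
  set a := S w; set b := D i w; set v := (2 * n%:R)^-1.
  have v0 : 0 < v by rewrite invr_gt0 mulr_gt0.
  have -> : n%:R = (2 * v)^-1 :> R by rewrite /v; field; rewrite gt_eqF.
  rewrite -subr_ge0.
  rewrite (_ : _ - _ = v * (a ^+ 2 - 4 * v^-1 * b ^+ 2) ^+ 2 +
     2 * (a * b - b ^+ 2) ^+ 2); last first.
    by field; rewrite gt_eqF.
  by rewrite addr_ge0// mulr_ge0 ?sqr_ge0// ltW.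
apply: (le_trans le1).
rewrite /G RintegralD//; first last.
- exact: integrable_realZ.
- by apply: integrable_realD => //; exact: integrable_realZ.
rewrite RintegralD//; [|exact: integrable_realZ|exact: integrable_realZ].
rewrite !RintegralZl// D0// mulr0 addr0.
have K0 : 0 <= K.
  apply: le_trans (DK _ ilt); apply: Rintegral_ge0 => w _.
  exact: (exprn_even_ge0 _ (isT : ~~ odd 4)).
have n1 : 1 <= n%:R :> R by rewrite ler1n; exact: leq_ltn_trans ilt.
have in' : i%:R <= n%:R :> R by rewrite ler_nat ltnW.
apply: (@le_trans _ _ (c * (70 * K * n%:R * i%:R) + (3 + 32 * n%:R) * K)).
  apply: lerD; apply: ler_wpM2l => //.
  - by rewrite /c addr_ge0// invr_ge0 mulr_ge0// ltW.
  - exact: DK.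
rewrite /c mulrDl mul1r (_ : (2 * n%:R)^-1 * _ = 35 * K * i%:R); last first.
  by field; rewrite gt_eqF.
rewrite -(natr1 i) mulrDr mulr1 -addrA lerD2l.
have h1 : K * i%:R <= K * n%:R by rewrite ler_wpM2l.
have h2 : K * 1 <= K * n%:R by rewrite ler_wpM2l.
nra.
Qed.

Lemma second_moment_orthogonal (I : eqType) (r : seq I) (V : I -> T -> R) (K : R) :
  uniq r ->
  (forall i, measurable_fun setT (V i)) ->
  (forall i, P.-integrable setT (EFin \o (fun w => V i w ^+ 2))) ->
  (forall i, \int[P]_w (V i w ^+ 2) <= K) ->
  (forall i j, i != j -> \int[P]_w (V i w * V j w) = 0) ->
  P.-integrable setT (EFin \o (fun w => (\sum_(i <- r) V i w) ^+ 2)) /\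
  \int[P]_w ((\sum_(i <- r) V i w) ^+ 2) <= K * (size r)%:R.
Proof.
move=> ur mV iV VK V0.
have iVV i j : P.-integrable setT (EFin \o (fun w => V i w * V j w)).
  apply: (@integrable_le_norm _ _ _ _ _ (fun w => V i w ^+ 2 + V j w ^+ 2)).
  - exact: measurable_funM.
  - exact: integrable_realD.
  - move=> w; set a := V i w; set b := V j w.
    have := sqr_ge0 (a - b); have := sqr_ge0 (a + b).
    by rewrite !expr2 => h1 h2; rewrite ler_norml; apply/andP; split; nra.
elim: r ur => [_|i r ih /= /andP[ir ur]].
  under eq_fun do rewrite big_nil expr0n /=.
  rewrite Rintegral_cst// mul0r mulr0; split => //.
  exact: integrable_real_cst.
have {ih ur}[iS SK] := ih ur.
set S := fun w => \sum_(i <- r) V i w in iS SK.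
have SE w : (\sum_(i <- i :: r) V i w) ^+ 2 =
    V i w ^+ 2 + 2 * (\sum_(j <- r) V i w * V j w) + S w ^+ 2.
  by rewrite big_cons -mulr_sumr -/(S w); ring.
under eq_fun do rewrite SE.
have iC : P.-integrable setT (EFin \o (fun w => 2 * (\sum_(j <- r) V i w * V j w))).
  by apply: integrable_realZ; exact: integrable_real_sum.
split; first by apply: integrable_realD => //; exact: integrable_realD.
rewrite RintegralD//; last exact: integrable_realD.
rewrite RintegralD// RintegralZl//; last exact: integrable_real_sum.
rewrite Rintegral_sum// big_seq big1 ?mulr0 ?addr0; last first.
  by move=> j jr; apply: V0; apply: contraNneq ir => ->.
by rewrite -(natr1 (size r)) mulrDr mulr1 addrC lerD.
Qed.

End moments.

(** * Pointwise bounds for the Taylor remainders in Stein's expansion *)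

Section real_inequalities.
Context {R : realType}.

(* AM-GM with the free weight [eta], so that only the fourth moments of [v]
   and [z] enter. *)
Lemma stein_remainder_bound (v z eta m : R) : 0 < eta -> 0 < m ->
  (1 + `|v|) * `|z| ^+ 3 + (1 + `|v|) * `|z| / m <=
  z ^+ 4 * (eta^-1 + eta * m) + (eta * m ^+ 2)^-1 +
  4 * (eta / m) * (1 + v ^+ 4).
Proof.
move=> eta0 m0.
have norm4 (y : R) : y ^+ 4 = `|y| ^+ 4.
  by rewrite -normrX ger0_norm// (exprn_even_ge0 _ (isT : ~~ odd 4)).
rewrite (norm4 z) (norm4 v).
move: (normr_ge0 v) (normr_ge0 z); set a := `|v|; set b := `|z| => a0 b0.
set e := eta^-1; set u := m^-1.
have e0 : 0 < e by rewrite invr_gt0.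
have u0 : 0 < u by rewrite invr_gt0.
(* In each of [s1] to [s6] the gap is an explicit square, a sum of squares, or a square times a
   nonnegative factor. [s1] to [s3] serve the first summand ([t1]), [s4] to [s6] the second
   ([t2]). *)
have s1 : (1 + a) * b ^+ 3 <= b ^+ 4 * e / 2 + eta / 2 * (b ^+ 2 * (1 + a) ^+ 2).
  rewrite -subr_ge0 (_ : _ - _ = (b ^+ 2 - eta * b * (1 + a)) ^+ 2 * e / 2).
    by rewrite divr_ge0// mulr_ge0 ?sqr_ge0// ltW.
  by rewrite /e; field; rewrite gt_eqF.
have s2 : b ^+ 2 * (1 + a) ^+ 2 <= (m * b ^+ 4 + u * (1 + a) ^+ 4) / 2.
  rewrite -subr_ge0 (_ : _ - _ = (m * b ^+ 2 - (1 + a) ^+ 2) ^+ 2 * u / 2).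
    by rewrite divr_ge0// mulr_ge0 ?sqr_ge0// ltW.
  by rewrite /u; field; rewrite gt_eqF.
have s3 : (1 + a) ^+ 4 <= 8 * (1 + a ^+ 4).
  rewrite -subr_ge0 (_ : _ - _ = (1 - a) ^+ 2 * (7 * (1 + a ^+ 2) + 10 * a)).
    by rewrite mulr_ge0 ?sqr_ge0// addr_ge0 ?mulr_ge0// addr_ge0// sqr_ge0.
  by ring.
have s4 : (1 + a) * b <= b ^+ 2 * e / 2 + eta / 2 * (1 + a) ^+ 2.
  rewrite -subr_ge0 (_ : _ - _ = (b - eta * (1 + a)) ^+ 2 * e / 2).
    by rewrite divr_ge0// mulr_ge0 ?sqr_ge0// ltW.
  by rewrite /e; field; rewrite gt_eqF.
have s5 : b ^+ 2 <= (m * b ^+ 4 + u) / 2.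
  rewrite -subr_ge0 (_ : _ - _ = (m * b ^+ 2 - 1) ^+ 2 * u / 2).
    by rewrite divr_ge0// mulr_ge0 ?sqr_ge0// ltW.
  by rewrite /u; field; rewrite gt_eqF.
have s6 : (1 + a) ^+ 2 <= 3 + a ^+ 4.
  rewrite -subr_ge0 (_ : _ - _ = (a ^+ 2 - 1) ^+ 2 + (a - 1) ^+ 2).
    by rewrite addr_ge0 ?sqr_ge0.
  by ring.
have t1 : (1 + a) * b ^+ 3 <= b ^+ 4 * e / 2 + eta * m * b ^+ 4 / 4 +
    2 * eta * u * (1 + a ^+ 4).
  apply: (le_trans s1); rewrite -addrA lerD2l.
  apply: (@le_trans _ _ (eta / 2 * ((m * b ^+ 4 + u * (8 * (1 + a ^+ 4))) / 2))).
    apply: ler_wpM2l; first by rewrite divr_ge0// ltW.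
    apply: (le_trans s2); rewrite ler_wpM2r// lerD2l.
    by rewrite ler_wpM2l// ltW.
  by rewrite le_eqVlt; apply/orP; left; apply/eqP; field.
have t2 : (1 + a) * b * u <= b ^+ 4 * e / 4 + u ^+ 2 * e / 4 +
    eta * u / 2 * (3 + a ^+ 4).
  apply: (le_trans (ler_wpM2r (ltW u0) s4)).
  rewrite mulrDl; apply: lerD.
    have eu : 0 <= e / 2 * u by rewrite mulr_ge0 ?divr_ge0 ?ltW.
    have h := ler_wpM2r eu s5.
    have -> : b ^+ 2 * e / 2 * u = b ^+ 2 * (e / 2 * u) by ring.
    apply: (le_trans h); rewrite le_eqVlt; apply/orP; left; apply/eqP.
    by rewrite /u /e; field; rewrite !gt_eqF.
  have eu : 0 <= eta / 2 * u by rewrite mulr_ge0 ?divr_ge0 ?ltW.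
  have h := ler_wpM2l eu s6.
  rewrite mulrAC; apply: (le_trans h); rewrite le_eqVlt; apply/orP; left; apply/eqP.
  by ring.
have -> : (eta * m ^+ 2)^-1 = u ^+ 2 * e.
  by rewrite /u /e; field; rewrite !gt_eqF.
apply: (le_trans (lerD t1 t2)).
have p1 : 0 <= b ^+ 4 * e by rewrite mulr_ge0 ?exprn_ge0// ltW.
have p2 : 0 <= b ^+ 4 * eta * m by rewrite !mulr_ge0 ?exprn_ge0// ltW.
have p3 : 0 <= u ^+ 2 * e by rewrite mulr_ge0 ?exprn_ge0// ltW.
have p4 : 0 <= eta * u by rewrite mulr_ge0 ?ltW.
have p5 : 0 <= eta * u * a ^+ 4 by rewrite mulr_ge0 ?exprn_ge0// ltW.
rewrite -subr_ge0.
rewrite (_ : _ - _ = b ^+ 4 * e / 4 + b ^+ 4 * eta * m * (3 / 4) +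
  u ^+ 2 * e * (3 / 4) + eta * u / 2 + eta * u * a ^+ 4 * (3 / 2)); last by field.
lra.
Qed.

(** The mean value theorem replaces a second derivative, which the Stein solution of a piecewise
    linear [h] lacks at the corners. *)
Lemma taylor1_bound (f f' : R -> R) (K v z : R) :
  (forall y : R, is_derive y 1 f (f' y)) ->
  (forall y y', `|f' y - f' y'| <= K * (1 + `|y|) * `|y - y'|) ->
  `|f (v + z) - f v - z * f' v| <= K * (1 + `|v|) * z ^+ 2.
Proof.
move=> df lf.
have cf : continuous f.
  by move=> y; apply/differentiable_continuous/derivable1_diffP; have [] := df y.
have cfw A : {within A, continuous f} by exact: continuous_subspaceT.
have K0 : 0 <= K.
  have := lf 0 1; rewrite normr0 addr0 mulr1 sub0r normrN1 mulr1.
  by move=> /(le_trans (normr_ge0 _)).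
suff [c cz fE] : exists2 c, `|v - c| <= `|z| & f (v + z) - f v = f' c * z.
  rewrite fE mulrC -mulrBr normrM distrC.
  apply: (le_trans (ler_wpM2l (normr_ge0 _) (lf v c))).
  rewrite -real_normK ?num_real// expr2 mulrC -!mulrA.
  by do 2 (apply: ler_wpM2l => //); rewrite ler_wpM2r.
have [z0|z0|z0] := ltgtP z 0; last first.
- by exists v; rewrite ?subrr ?normr0// z0 addr0 subrr mulr0.
- have [c] := @MVT _ f f' v (v + z) (ltr_pwDr z0 (lexx _)) (fun y _ => df y) (cfw _).
  rewrite in_itv /= => /andP[c1 c2]; rewrite [v + z - v]addrC addKr => E.
  exists c => //; rewrite ltr0_norm ?subr_lt0// gtr0_norm//; lra.
- have vz : v + z < v by rewrite gtrDl.
  have [c] := @MVT _ f f' (v + z) v vz (fun y _ => df y) (cfw _).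
  rewrite in_itv /= => /andP[c1 c2] E.
  exists c; last by rewrite -opprB E; ring.
  rewrite gtr0_norm ?subr_gt0// ltr0_norm//; lra.
Qed.

End real_inequalities.

(** * The standard normal density and its tails *)

Section normal_density.
Context {R : realType}.
Local Notation mu := (@lebesgue_measure R).
Local Notation phi := (normal_pdf (0 : R) 1).
Local Notation c0 := (@normal_peak R 1).

Lemma std_normal_pdfE : phi = fun y : R => c0 * expR (- (y ^+ 2 / 2)).
Proof.
rewrite normal_pdfE ?oner_neq0//; apply/funext => y.
by rewrite /= /normal_fun subr0 expr1n mulNr.
Qed.

Lemma std_normal_pdf_gt0 y : 0 < phi y.
Proof. by rewrite std_normal_pdfE mulr_gt0 ?expR_gt0// normal_peak_gt0// oner_neq0. Qed.

Lemma std_normal_pdfN y : phi (- y) = phi y.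
Proof. by rewrite std_normal_pdfE sqrrN. Qed.

Lemma std_normal_pdf_ge1 y : `|y| <= 1 -> phi 1 <= phi y.
Proof.
move=> y1; rewrite std_normal_pdfE; apply: ler_wpM2l; first exact: normal_peak_ge0.
rewrite ler_expR lerN2 ler_pM2r ?invr_gt0// expr1n -real_normK ?num_real//.
by rewrite expr_le1.
Qed.

Lemma is_derive_std_normal_pdf (y : R) : is_derive y 1 phi (- y * phi y).
Proof.
rewrite std_normal_pdfE.
have d1 : is_derive y 1 (fun z : R => - (z ^+ 2 / 2)) (- y).
  by apply: is_derive_eq; rewrite /= !scaler0 /GRing.scale /= add0r; field.
have d2 : is_derive y 1 (expR \o (fun z : R => - (z ^+ 2 / 2)))
    (- y * expR (- (y ^+ 2 / 2))).
  by apply: is_derive_eq; rewrite mulrC.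
have : is_derive y 1 (c0 \*: (expR \o (fun z : R => - (z ^+ 2 / 2))))
    (c0 *: (- y * expR (- (y ^+ 2 / 2)))).
  exact: is_deriveZ.
rewrite /GRing.scale /=.
by rewrite [- y * (c0 * _)]mulrCA.
Qed.

Lemma cvg_std_normal_pdf : phi y @[y --> +oo] --> (0 : R).
Proof.
rewrite std_normal_pdfE.
rewrite -[X in _ --> X](mulr0 c0); apply: cvgM; first exact: cvg_cst.
apply: (@squeeze_cvgr _ _ _ _ (fun=> 0) (fun y : R => expR (- y))).
- near=> y; rewrite expR_ge0 ler_expR lerN2 /=.
  have : 2 <= y by near: y; exact: nbhs_pinfty_ge.
  nra.
- exact: cvg_cst.
- exact: cvgr_expR.
Unshelve. all: by end_near. Qed.

Lemma integrable_phi (A : set R) : measurable A -> mu.-integrable A (EFin \o phi).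
Proof.
move=> mA; apply: (integrableS measurableT) => //.
exact: integrable_normal_pdf.
Qed.

(** On the tail [a * phi y <= y * phi y], and [- phi] is a primitive of [y * phi y]. *)
Lemma mills_ratio_right (a : R) : 0 < a ->
  a * \int[mu]_(y in `[a, +oo[) phi y <= phi a.
Proof.
move=> a0.
have cphi : continuous phi by apply: continuous_normal_pdf; exact: oner_neq0.
have dN (y : R) : is_derive y 1 (fun z => - phi z) (y * phi y).
  have h := is_derive_std_normal_pdf y.
  by apply: is_derive_eq; rewrite mulNr opprK.
have cN : continuous (fun y : R => y * phi y).
  by move=> y; apply: cvgM; [exact: cvg_id|exact: cphi].
have E : (\int[mu]_(y in `[a, +oo[) (y * phi y)%:E = (phi a)%:E)%E.
  rewrite (@ge0_continuous_FTC2y _ _ (fun z => - phi z) a 0).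
  - by rewrite EFinN oppeK add0e.
  - by move=> y ay; rewrite mulr_ge0 ?normal_pdf_ge0// (le_trans (ltW a0)).
  - exact: continuous_subspaceT.
  - by rewrite -[X in _ --> X]oppr0; apply: cvgN; exact: cvg_std_normal_pdf.
  - by move=> y _; have [] := dN y.
  - by apply: cvgN; apply: cvg_at_right_filter; exact: cphi.
  - by move=> y _; rewrite derive1E; exact: derive_val.
have iy : mu.-integrable `[a, +oo[ (EFin \o (fun y : R => y * phi y)).
  apply/integrableP; split.
    by apply/measurable_EFinP; apply/measurable_funTS; exact: continuous_measurable_fun.
  rewrite (_ : integral _ _ _ = (phi a)%:E) ?ltry// -E.
  apply: eq_integral => y; rewrite inE /= in_itv /= andbT => ay.
  by rewrite ger0_norm// mulr_ge0 ?normal_pdf_ge0// (le_trans (ltW a0)).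
rewrite -RintegralZl//; last exact: integrable_phi.
rewrite [leRHS](_ : _ = \int[mu]_(y in `[a, +oo[) (y * phi y)); last first.
  by rewrite /Rintegral E.
apply: le_Rintegral => //.
  rewrite (_ : _ \o _ = (fun y => a%:E * (EFin \o phi) y)%E)//.
  by apply: integrableZl => //; exact: integrable_phi.
by move=> y; rewrite /= in_itv /= andbT => ay; rewrite ler_wpM2r ?normal_pdf_ge0.
Qed.

Lemma mills_ratio_left (a : R) : a < 0 ->
  - a * \int[mu]_(y in `]-oo, a]) phi y <= phi a.
Proof.
move=> a0; have := @mills_ratio_right (- a); rewrite oppr_gt0 => /(_ a0).
rewrite std_normal_pdfN; congr (_ * _ <= _).
rewrite /Rintegral -[in RHS](opprK a) ge0_integration_by_substitutionNy.
- by congr fine; apply: eq_integral => y _ /=; rewrite std_normal_pdfN.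
- by apply: continuous_subspaceT; apply: continuous_normal_pdf; exact: oner_neq0.
- by move=> y _; exact: normal_pdf_ge0.
Qed.

Lemma integral_phi : \int[mu]_y phi y = 1.
Proof. by rewrite /Rintegral integral_normal_pdf ?oner_neq0. Qed.

End normal_density.

(** * The bounded solution of Stein's equation *)

Section stein_equation.
Context {R : realType}.
Local Notation mu := (@lebesgue_measure R).
Local Notation phi := (normal_pdf (0 : R) 1).
Variables (h : R -> R) (L : R).
Hypothesis L0 : 0 <= L.
Hypothesis h01 : forall y, 0 <= h y <= 1.
Hypothesis hL : forall y y', `|h y - h y'| <= L * `|y - y'|.

Definition normal_mean : R := \int[mu]_y (h y * phi y).
Let c := normal_mean.
Let g y := (h y - c) * phi y.

Let ch : continuous h.
Proof.
have L1 : 0 < L + 1 by rewrite ltr_wpDl.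
move=> y; apply/cvgrPdist_lt => e e0; near=> z.
apply: (le_lt_trans (hL _ _)).
apply: (@le_lt_trans _ _ ((L + 1) * `|y - z|)); first by rewrite ler_wpM2r// lerDl.
rewrite mulrC -ltr_pdivlMr//.
near: z; apply/nbhs_ballP; exists (e / (L + 1)) => /=; first exact: divr_gt0.
by move=> z.
Unshelve. all: by end_near. Qed.

Let cphi : continuous phi.
Proof. by apply: continuous_normal_pdf; exact: oner_neq0. Qed.

Lemma integrable_phi_bounded (k : R -> R) (A : set R) : continuous k ->
  (forall y, `|k y| <= 1) -> measurable A ->
  mu.-integrable A (EFin \o (fun y => k y * phi y)).
Proof.
move=> ck k1 mA; apply: le_integrable (integrable_phi mA) => //.
  apply/measurable_EFinP/measurable_funTS; apply: continuous_measurable_fun.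
  by move=> y; apply: cvgM; [exact: ck|exact: cphi].
move=> y _ /=; rewrite lee_fin normrM ler_piMl//.
Qed.

Let h1 y : `|h y| <= 1.
Proof. by case/andP: (h01 y) => ? ?; rewrite ger0_norm. Qed.

Lemma normal_mean01 : 0 <= c <= 1.
Proof.
apply/andP; split.
  by apply: Rintegral_ge0 => y _; rewrite mulr_ge0 ?normal_pdf_ge0//; case/andP: (h01 y).
rewrite -(@integral_phi R); apply: le_Rintegral => //.
- exact: integrable_phi_bounded.
- exact: integrable_phi.
- by move=> y _; rewrite ler_piMl ?normal_pdf_ge0//; case/andP: (h01 y).
Qed.

Let hc1 y : `|h y - c| <= 1.
Proof.
case/andP: (h01 y) => a1 a2; case/andP: normal_mean01 => b1 b2.
by rewrite ler_norml; apply/andP; split; lra.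
Qed.

Let ig (A : set R) : measurable A -> mu.-integrable A (EFin \o g).
Proof.
apply: integrable_phi_bounded => //.
by move=> y; apply: cvgB; [exact: ch|exact: cvg_cst].
Qed.

Let gphi y : `|g y| <= phi y.
Proof.
by rewrite normrM [X in _ * X]ger0_norm ?normal_pdf_ge0// ler_piMl// normal_pdf_ge0.
Qed.

Let Fg y := \int[mu]_(z in `]-oo, y]) g z.

Let integral_g_le (A : set R) : measurable A ->
  `|\int[mu]_(z in A) g z| <= \int[mu]_(z in A) phi z.
Proof.
move=> mA.
apply: (@le_trans _ _ (\int[mu]_(z in A) `|g z|)).
  by apply: le_normr_Rintegral => //; exact: ig.
apply: le_Rintegral => //.
- by apply: integrable_norm; exact: ig.
- exact: integrable_phi.
Qed.

Let Fg_left y : `|Fg y| <= \int[mu]_(z in `]-oo, y]) phi z.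
Proof. exact: integral_g_le. Qed.

Let int_g : \int[mu]_z g z = 0.
Proof.
rewrite /g.
have -> : \int[mu]_z ((h z - c) * phi z) = \int[mu]_z (h z * phi z - c * phi z).
  by apply: eq_Rintegral => z _; rewrite mulrBl.
rewrite RintegralB//.
- by rewrite RintegralZl ?integral_phi ?mulr1 ?subrr//; exact: integrable_phi.
- exact: integrable_phi_bounded.
- rewrite (_ : _ \o _ = (fun y => c%:E * (EFin \o phi) y)%E)//.
  by apply: integrableZl => //; exact: integrable_phi.
Qed.

(** As [g] has total integral [0], [Fg y] is also minus the integral over the right tail. So [Fg] is
    controlled by whichever Gaussian tail is the smaller. *)
Let Fg_right y : `|Fg y| <= \int[mu]_(z in `[y, +oo[) phi z.
Proof.
have := @Rintegral_itvB R g -oo%O +oo%O y.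
rewrite set_itvNyy => /(_ (ig measurableT) isT isT).
rewrite int_g sub0r -/(Fg y) => E.
rewrite -normrN E (le_trans (integral_g_le _))//.
rewrite Rintegral_itv_obnd_cbnd//.
exact: integrable_phi.
Qed.

Let Fg1 y : `|Fg y| <= 1.
Proof.
apply: (le_trans (Fg_left y)); rewrite -[leRHS](@integral_phi R).
have fin (A : set R) : measurable A ->
    (\int[mu]_(z in A) (phi z)%:E)%E \is a fin_num.
  move=> mA; apply: (@integrable_fin_num _ _ _ mu A _ (EFin \o phi)) => //.
  exact: integrable_phi.
apply: fine_le; [exact: fin|exact: fin|].
apply: ge0_subset_integral => //.
- by apply/measurable_EFinP; exact: measurable_normal_pdf.
- by move=> z _; rewrite lee_fin normal_pdf_ge0.
Qed.

Let dFg (y : R) : is_derive y 1 Fg (g y).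
Proof.
have cg : {for y, continuous g}.
  apply: cvgM; last exact: cphi.
  by apply: cvgB; [exact: ch|exact: cvg_cst].
(* The endpoint [y + 1] is arbitrary; it only has to lie beyond [y]. *)
have [] := @continuous_FTC1 R g -oo%O y (y + 1) _ _ _ cg.
- by rewrite ltrDl.
- exact: ig.
- exact: ltNyr.
by move=> d1 d2; apply: DeriveDef => //; rewrite -derive1E.
Qed.

(** The density is an integrating factor: [(phi f)' = phi (f' - y f)], so the equation reads
    [(phi f)' = g], and integrating from minus infinity selects the bounded solution. The formula
    for the derivative is then the equation itself. *)
Definition stein_sol (y : R) : R := Fg y / phi y.
Definition stein_sol' (y : R) : R := y * stein_sol y + (h y - c).

Lemma is_derive_stein_sol (y : R) : is_derive y 1 stein_sol (stein_sol' y).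
Proof.
have p0 : phi y != 0 by rewrite gt_eqF// std_normal_pdf_gt0.
have d1 := is_deriveV p0 (is_derive_std_normal_pdf y).
have d2 := is_deriveM (dFg y) d1.
apply: (is_derive_eq d2).
rewrite /stein_sol' /stein_sol /g /GRing.scale /=; field.
exact: p0.
Qed.

(** The tail on the side of [y] is used, left for [y < 0] and right for [y > 0], and the Mills ratio
    there cancels the division by [phi y]. *)
Lemma stein_sol_mul_le1 y : `|y * stein_sol y| <= 1.
Proof.
rewrite /stein_sol mulrA normrM normfV [X in _ / X]ger0_norm ?normal_pdf_ge0//.
rewrite ler_pdivrMr ?std_normal_pdf_gt0// mul1r normrM.
have [y0|y0|->] := ltgtP y 0; last by rewrite normr0 mul0r normal_pdf_ge0.
- apply: le_trans (mills_ratio_left y0); rewrite ltr0_norm//.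
  by rewrite ler_wpM2l// oppr_ge0 ltW.
- apply: le_trans (mills_ratio_right y0); rewrite gtr0_norm//.
  by rewrite ler_wpM2l// ltW.
Qed.

(** For [|y| <= 1] the numerator [Fg] is at most [1] and [phi] at least [phi 1]; for larger [|y|]
    the bound on [y * stein_sol y] already suffices. *)
Let Kf : R := 1 + (phi 1)^-1.

Lemma stein_sol_le y : `|stein_sol y| <= Kf.
Proof.
have p1 : 0 < (phi 1)^-1 by rewrite invr_gt0 std_normal_pdf_gt0.
have [y1|/ltW y1] := leP `|y| 1.
  apply: (@le_trans _ _ (phi 1)^-1); last by rewrite lerDr.
  rewrite /stein_sol normrM normfV [X in _ / X]ger0_norm ?normal_pdf_ge0//.
  rewrite -[leRHS]mul1r ler_pM ?invr_ge0 ?normal_pdf_ge0//.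
  by rewrite lef_pV2 ?posrE ?std_normal_pdf_gt0// std_normal_pdf_ge1.
have := stein_sol_mul_le1 y; rewrite normrM.
have := normr_ge0 (stein_sol y).
rewrite /Kf; nra.
Qed.

Lemma stein_sol'_le y : `|stein_sol' y| <= 2.
Proof.
apply: (le_trans (ler_normD _ _)).
by have := stein_sol_mul_le1 y; have := hc1 y; lra.
Qed.

Let csol : continuous stein_sol.
Proof.
move=> y; apply/differentiable_continuous/derivable1_diffP.
by have [] := is_derive_stein_sol y.
Qed.

Lemma stein_sol_lip y y' : `|stein_sol y - stein_sol y'| <= 2 * `|y - y'|.
Proof.
wlog yy' : y y' / y <= y'.
  move=> H; have [|/ltW] := leP y y'; first exact: H.
  by move=> /H; rewrite distrC (distrC y' y).
rewrite distrC (distrC y y').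
have [] := @MVT_segment R stein_sol stein_sol' y y' yy'
  (fun z _ => is_derive_stein_sol z).
  exact: continuous_subspaceT.
move=> z _ ->; rewrite normrM; apply: ler_wpM2r => //; exact: stein_sol'_le.
Qed.

(** The factor [1 + |y|] in the Lipschitz bound comes from the term [y f] of [f' = y f + h - Nh]: a
    change of [f] is multiplied by [y], a change of [y] by the bounded [f]. A single [K] covers all
    bounds. *)
Lemma stein_solution : exists (f f' : R -> R) (K : R),
  [/\ (forall y : R, is_derive y 1 f (f' y)),
      measurable_fun setT f /\ measurable_fun setT f',
      (forall y, `|f y| <= K) /\ (forall y, `|f' y| <= K),
      (forall y y', `|f' y - f' y'| <= K * (1 + `|y|) * `|y - y'|) &
      forall y, f' y - y * f y = h y - normal_mean].
Proof.
have p1 : 0 < (phi 1)^-1 by rewrite invr_gt0 std_normal_pdf_gt0.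
have msol : measurable_fun setT stein_sol by exact: continuous_measurable_fun.
exists stein_sol, stein_sol', (2 + Kf + L); split.
- exact: is_derive_stein_sol.
- split => //; apply: measurable_funD; first exact: measurable_funM.
  by apply: measurable_funB => //; exact: continuous_measurable_fun.
- split=> y.
    by apply: (le_trans (stein_sol_le y)); have := L0; rewrite /Kf; lra.
  by apply: (le_trans (stein_sol'_le y)); have := L0; rewrite /Kf; lra.
- move=> y y'.
  have -> : stein_sol' y - stein_sol' y' = y * (stein_sol y - stein_sol y') +
      (y - y') * stein_sol y' + (h y - h y') by rewrite /stein_sol'; ring.
  apply: (le_trans (ler_normD _ _)).
  apply: (le_trans (lerD (ler_normD _ _) (lexx _))).
  rewrite normrM [X in _ + X + _ <= _]normrM.
  have b1 := ler_wpM2l (normr_ge0 y) (stein_sol_lip y y').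
  have b2 := ler_wpM2l (normr_ge0 (y - y')) (stein_sol_le y').
  apply: (le_trans (lerD (lerD b1 b2) (hL y y'))).
  rewrite -subr_ge0 (_ : _ - _ = `|y - y'| * (2 + (Kf + L) * `|y|)); last by ring.
  have Kf0 : 0 <= Kf + L by have := L0; rewrite /Kf; lra.
  by rewrite mulr_ge0// addr_ge0// mulr_ge0.
- by move=> y; rewrite /stein_sol' addrC addKr.
Qed.

End stein_equation.

(** * Closure properties of [avoids] *)

Section avoidance.
Context {d : measure_display} {T : measurableType d} {R : realType}.
Variable P : probability T R.
Context {I : choiceType}.
Variables (Z : I -> {RV P >-> R}) (i : I).

Lemma avoids_cst (k : R) : avoids Z i (fun=> k).
Proof. exact: measurable_cst. Qed.

Lemma avoidsD F G : avoids Z i F -> avoids Z i G -> avoids Z i (fun w => F w + G w).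
Proof. exact: measurable_funD. Qed.

Lemma avoidsM F G : avoids Z i F -> avoids Z i G -> avoids Z i (fun w => F w * G w).
Proof. exact: measurable_funM. Qed.

Lemma avoidsX n F : avoids Z i F -> avoids Z i (fun w => F w ^+ n).
Proof. exact: measurable_funX. Qed.

Lemma avoids_comp (g : R -> R) F : measurable_fun setT g -> avoids Z i F ->
  avoids Z i (fun w => g (F w)).
Proof. by move=> mg mF; exact: (measurableT_comp mg mF). Qed.

Lemma avoids_sum (J : Type) (r : seq J) (p : pred J) (F : J -> T -> R) :
  (forall j, p j -> avoids Z i (F j)) ->
  avoids Z i (fun w => \sum_(j <- r | p j) F j w).
Proof.
move=> aF; elim: r => [|j r ih].
  by under eq_fun do rewrite big_nil; exact: avoids_cst.
under eq_fun do rewrite big_cons.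
by case: (boolP (p j)) => // pj; apply: avoidsD => //; exact: aF.
Qed.

End avoidance.

(** * Moments of the row sums, the [q_i] and the negligible terms *)

Section quadratic_forms.
Context {d : measure_display} {T : measurableType d} {R : realType}.
Variable P : probability T R.
Variables (x : nat -> {RV P >-> R}) (s : nat -> nat -> {RV P >-> R}).
Variables (kx ks : R).

(** The family [joint_family] with values in the random variables, as [avoids] expects. *)
Definition entries (i : nat + (nat * nat)) : {RV P >-> R} :=
  match i with inl j => x j | inr ab => s ab.1 ab.2 end.

Hypothesis indep : mutually_independent P (fun i => entries i : T -> R).
Hypothesis x4 : forall j, P.-integrable setT (EFin \o (fun w => x j w ^+ 4)).
Hypothesis s4 : forall i j, P.-integrable setT (EFin \o (fun w => s i j w ^+ 4)).
Hypothesis Ex2 : forall j, \int[P]_w (x j w ^+ 2) = 1.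
Hypothesis Ex4 : forall j, \int[P]_w (x j w ^+ 4) = kx.
Hypothesis Es1 : forall i j, \int[P]_w (s i j w) = 0.
Hypothesis Es2 : forall i j, \int[P]_w (s i j w ^+ 2) = 1.
Hypothesis Es4 : forall i j, \int[P]_w (s i j w ^+ 4) = ks.

Local Notation L4 := (fourth_integrable P).
Local Notation integ f := (P.-integrable setT (EFin \o f)).

Definition rowsum (i n : nat) (w : T) : R := \sum_(j < n) s i j w * x j w.

(** This is [q_i] with the pairs grouped by their larger index [k]. The increment is [s i k] times a
    quantity that does not involve [s i k], so the partial sums in [n] behave like a martingale. *)
Definition rowquad (i n : nat) (w : T) : R :=
  \sum_(k < n) s i k w * x k w * rowsum i k w.

Lemma fourth_integrable_x j : L4 (x j).
Proof. by split. Qed.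

Lemma fourth_integrable_s i j : L4 (s i j).
Proof. by split. Qed.

Lemma avoids_s_x i j k : avoids entries (inr (i, j)) (x k).
Proof. exact: (@avoids_coord _ _ _ _ _ entries (inr (i, j)) (inl k)). Qed.

Lemma avoids_s_s i j i' j' : (i != i') || (j != j') ->
  avoids entries (inr (i, j)) (s i' j').
Proof.
move=> ij; apply: (@avoids_coord _ _ _ _ _ entries (inr (i, j)) (inr (i', j'))).
by rewrite -[_ == _]/((i == i') && (j == j')) negb_and.
Qed.

Lemma avoids_x_x k j : k != j -> avoids entries (inl k) (x j).
Proof. exact: (@avoids_coord _ _ _ _ _ entries (inl k) (inl j)). Qed.

Lemma avoids_x_s k i j : avoids entries (inl k) (s i j).
Proof. exact: (@avoids_coord _ _ _ _ _ entries (inl k) (inr (i, j))). Qed.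

Lemma avoids_s_rowsum i k i' n : (i != i') || (n <= k)%N ->
  avoids entries (inr (i, k)) (rowsum i' n).
Proof.
move=> h; apply: avoids_sum => j _; apply: avoidsM; last exact: avoids_s_x.
apply: avoids_s_s; case/orP: h => [->//|nk].
by rewrite (gtn_eqF (leq_trans (ltn_ord j) nk)) orbT.
Qed.

Lemma avoids_s_rowquad i k i' n : (i != i') || (n <= k)%N ->
  avoids entries (inr (i, k)) (rowquad i' n).
Proof.
move=> h; apply: avoids_sum => j _; apply: avoidsM; first apply: avoidsM.
- apply: avoids_s_s; case/orP: h => [->//|nk].
  by rewrite (gtn_eqF (leq_trans (ltn_ord j) nk)) orbT.
- exact: avoids_s_x.
- apply: avoids_s_rowsum; case/orP: h => [->//|nk].
  by rewrite (leq_trans (ltnW (ltn_ord j)) nk) orbT.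
Qed.

Lemma avoids_x_rowsum k i n : (n <= k)%N -> avoids entries (inl k) (rowsum i n).
Proof.
move=> nk; apply: avoids_sum => j _; apply: avoidsM; first exact: avoids_x_s.
by apply: avoids_x_x; rewrite (gtn_eqF (leq_trans (ltn_ord j) nk)).
Qed.

Lemma integral_sM i j G : avoids entries (inr (i, j)) G -> integ G ->
  integ (fun w => s i j w * G w) /\ \int[P]_w (s i j w * G w) = 0.
Proof.
move=> aG iG.
have [] := @Rintegral_avoidsM _ _ _ _ _ entries indep (inr (i, j)) idfun G _ aG _ iG.
- exact: measurable_id.
- exact: (fourth_integrable_integrable (fourth_integrable_s i j)).
by rewrite /= Es1 mul0r.
Qed.

Lemma integral_s2M i j G : avoids entries (inr (i, j)) G -> integ G ->
  integ (fun w => s i j w ^+ 2 * G w) /\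
  \int[P]_w (s i j w ^+ 2 * G w) = \int[P]_w G w.
Proof.
move=> aG iG.
have [] := @Rintegral_avoidsM _ _ _ _ _ entries indep (inr (i, j))
  (fun v => v ^+ 2) G _ aG _ iG.
- exact: exprn_measurable.
- exact: (fourth_integrable_sqr (fourth_integrable_s i j)).
by rewrite /= Es2 mul1r.
Qed.

Lemma integral_s4M i j G : avoids entries (inr (i, j)) G -> integ G ->
  integ (fun w => s i j w ^+ 4 * G w) /\
  \int[P]_w (s i j w ^+ 4 * G w) = ks * \int[P]_w G w.
Proof.
move=> aG iG.
have [] := @Rintegral_avoidsM _ _ _ _ _ entries indep (inr (i, j))
  (fun v => v ^+ 4) G _ aG _ iG.
- exact: exprn_measurable.
- exact: s4.
by rewrite /= Es4.
Qed.

Lemma integral_x4M j G : avoids entries (inl j) G -> integ G ->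
  integ (fun w => x j w ^+ 4 * G w) /\
  \int[P]_w (x j w ^+ 4 * G w) = kx * \int[P]_w G w.
Proof.
move=> aG iG.
have [] := @Rintegral_avoidsM _ _ _ _ _ entries indep (inl j)
  (fun v => v ^+ 4) G _ aG _ iG.
- exact: exprn_measurable.
- exact: x4.
by rewrite /= Ex4.
Qed.

Lemma kx_ge1 : 1 <= kx.
Proof.
rewrite -(Ex4 0%N).
have -> : 1 = \int[P]_w (2 * x 0%N w ^+ 2 - 1) :> R.
  rewrite RintegralB//; last 2 first.
  - by apply: integrable_realZ; exact: (fourth_integrable_sqr (fourth_integrable_x 0)).
  - exact: integrable_real_cst.
  rewrite RintegralZl//; last exact: (fourth_integrable_sqr (fourth_integrable_x 0)).
  rewrite Ex2 Rintegral_prob_cst; lra.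
apply: le_Rintegral => //.
  apply: integrable_realB; last exact: integrable_real_cst.
  by apply: integrable_realZ; exact: (fourth_integrable_sqr (fourth_integrable_x 0)).
move=> w _; have := sqr_ge0 (x 0%N w ^+ 2 - 1).
rewrite (_ : (_ - 1) ^+ 2 = x 0%N w ^+ 4 - (2 * x 0%N w ^+ 2 - 1)) ?subr_ge0//.
by ring.
Qed.

Lemma ks_ge0 : 0 <= ks.
Proof.
rewrite -(Es4 0%N 0%N); apply: Rintegral_ge0 => w _.
exact: (exprn_even_ge0 _ (isT : ~~ odd 4)).
Qed.

Let kap := ks * kx.

Lemma kap_ge0 : 0 <= kap.
Proof. by rewrite mulr_ge0 ?ks_ge0// (le_trans _ kx_ge1). Qed.

(** First [x k], then [s i k] is integrated out; each enters with power exactly four. *)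
Lemma fourth_moment_sxM i k G : L4 G ->
  avoids entries (inr (i, k)) G -> avoids entries (inl k) G ->
  [/\ L4 (fun w => x k w * G w), L4 (fun w => s i k w * (x k w * G w)) &
  \int[P]_w ((s i k w * (x k w * G w)) ^+ 4) = kap * \int[P]_w (G w ^+ 4)].
Proof.
move=> [mG iG] asG axG.
have [ixG xGE] := integral_x4M (avoidsX 4 axG) iG.
have asxG : avoids entries (inr (i, k)) (fun w => x k w ^+ 4 * G w ^+ 4).
  by apply: avoidsM; apply: avoidsX => //; exact: avoids_s_x.
have [isxG sxGE] := integral_s4M asxG ixG.
have mxG : measurable_fun setT (fun w => x k w * G w) by exact: measurable_funM.
split.
- split=> //; rewrite (_ : (fun w => _) = fun w => x k w ^+ 4 * G w ^+ 4)//.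
  by apply/funext => w; rewrite exprMn.
- split; first exact: measurable_funM.
  rewrite (_ : (fun w => _) = fun w => s i k w ^+ 4 * (x k w ^+ 4 * G w ^+ 4))//.
  by apply/funext => w; rewrite !exprMn.
- rewrite /kap -mulrA -xGE -sxGE.
  by apply: eq_Rintegral => w _; rewrite !exprMn.
Qed.

(** Martingale differences in [k]: [s i k] is centred and independent of [x k] and of the earlier
    partial sum. This gives [n^2] where the triangle inequality would give [n^4]. *)
Lemma rowsum_fourth i n : L4 (rowsum i n) /\
  \int[P]_w (rowsum i n w ^+ 4) <= 70 * kap * n%:R ^+ 2.
Proof.
have a4 k : L4 (fun w => s i k w * x k w) /\
    \int[P]_w ((s i k w * x k w) ^+ 4) = kap.
  have [_] := fourth_moment_sxM (fourth_integrable_cst P 1)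
    (@avoids_cst _ _ _ _ _ entries (inr (i, k)) 1) (@avoids_cst _ _ _ _ _ entries (inl k) 1).
  move=> h1 h2; split; first by move: h1; under eq_fun do rewrite mulr1.
  rewrite -[RHS]mulr1 -[X in _ * X](Rintegral_prob_cst P) -(expr1n R 4) -h2.
  by apply: eq_Rintegral => w _; rewrite mulr1.
have L4s m : L4 (rowsum i m).
  by apply: fourth_integrable_sum => j _; case: (a4 j).
split => //.
apply: (@fourth_moment_sum _ _ _ _ (fun k w => s i k w * x k w)).
- by move=> k _; case: (a4 k).
- by move=> k _; case: (a4 k) => _ ->.
- move=> k _; under eq_Rintegral do rewrite -/(rowsum i k _) -mulrA.
  apply: (integral_sM (i := i) (j := k) _ _).2.
    apply: avoidsM; first exact: avoids_s_x.
    by apply: avoidsX; apply: avoids_s_rowsum; rewrite leqnn orbT.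
  rewrite (_ : (fun w => _) =
    fun w => x k w * rowsum i k w * rowsum i k w * rowsum i k w).
    by apply: integrable_fourM.
  by apply/funext => w; ring.
Qed.

Lemma rowquad_incr i k :
  [/\ L4 (fun w => x k w * rowsum i k w),
      L4 (fun w => s i k w * (x k w * rowsum i k w)) &
  \int[P]_w ((s i k w * (x k w * rowsum i k w)) ^+ 4) <=
    70 * kap ^+ 2 * k%:R ^+ 2].
Proof.
have [L4r r4] := rowsum_fourth i k.
have [] := @fourth_moment_sxM i k (rowsum i k) L4r.
- by apply: avoids_s_rowsum; rewrite leqnn orbT.
- exact: avoids_x_rowsum.
move=> h1 h2 h3; split => //; rewrite h3.
have := ler_wpM2l kap_ge0 r4; congr (_ <= _); ring.
Qed.

(** A second application of [fourth_moment_sum], whose increments are bounded through the first one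
    in [rowsum_fourth]; hence [70 * 70] and the power [n^2 * n^2]. *)
Lemma rowquad_fourth i n : L4 (rowquad i n) /\
  \int[P]_w (rowquad i n w ^+ 4) <= 70 * 70 * kap ^+ 2 * n%:R ^+ 4.
Proof.
have qE m : rowquad i m = fun w => \sum_(k < m) s i k w * (x k w * rowsum i k w).
  by apply/funext => w; apply: eq_bigr => k _; rewrite mulrA.
have L4q m : L4 (rowquad i m).
  by rewrite qE; apply: fourth_integrable_sum => j _; case: (rowquad_incr i j).
split => //.
have -> : 70 * 70 * kap ^+ 2 * n%:R ^+ 4 = 70 * (70 * kap ^+ 2 * n%:R ^+ 2) * n%:R ^+ 2.
  by ring.
rewrite qE.
apply: (@fourth_moment_sum _ _ _ _ (fun k w => s i k w * (x k w * rowsum i k w))).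
- by move=> k _; case: (rowquad_incr i k).
- move=> k kn; case: (rowquad_incr i k) => _ _ h; apply: (le_trans h).
  apply: ler_wpM2l; first by rewrite mulr_ge0// sqr_ge0.
  by rewrite ler_sqr ?nnegrE// ler_nat ltnW.
- move=> k _.
  have qkE w : \sum_(j < k) s i j w * (x j w * rowsum i j w) = rowquad i k w.
    by rewrite qE.
  under eq_Rintegral do rewrite qkE -mulrA.
  apply: (integral_sM (i := i) (j := k) _ _).2.
    apply: avoidsM.
      apply: avoidsM; first exact: avoids_s_x.
      by apply: avoids_s_rowsum; rewrite leqnn orbT.
    by apply: avoidsX; apply: avoids_s_rowquad; rewrite leqnn orbT.
  rewrite (_ : (fun w => _) =
    fun w => (x k w * rowsum i k w) * rowquad i k w * rowquad i k w * rowquad i k w).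
    by apply: integrable_fourM => //; case: (rowquad_incr i k).
  by apply/funext => w; ring.
Qed.

(** Pythagoras conditionally on everything but [s i k]: the cross term is centred and the square of
    [s i k] averages to [1]. The weight [c] will carry the test function. *)
Lemma integral_sqr_incrM i k A B c :
  avoids entries (inr (i, k)) A -> avoids entries (inr (i, k)) B ->
  avoids entries (inr (i, k)) c ->
  integ (fun w => A w ^+ 2 * c w) -> integ (fun w => A w * B w * c w) ->
  integ (fun w => B w ^+ 2 * c w) ->
  \int[P]_w ((A w + s i k w * B w) ^+ 2 * c w) =
  \int[P]_w (A w ^+ 2 * c w) + \int[P]_w (B w ^+ 2 * c w).
Proof.
move=> aA aB ac iA iAB iB.
have [i1 E1] := @integral_sM i k (fun w => A w * B w * c w)
  (avoidsM (avoidsM aA aB) ac) iAB.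
have [i2 E2] := @integral_s2M i k (fun w => B w ^+ 2 * c w)
  (avoidsM (avoidsX 2 aB) ac) iB.
transitivity (\int[P]_w (A w ^+ 2 * c w + 2 * (s i k w * (A w * B w * c w)) +
    s i k w ^+ 2 * (B w ^+ 2 * c w))).
  by apply: eq_Rintegral => w _; ring.
rewrite RintegralD//; last by apply: integrable_realD => //; exact: integrable_realZ.
rewrite RintegralD//; last exact: integrable_realZ.
by rewrite RintegralZl// E1 E2 mulr0 addr0.
Qed.

Lemma integrable_fourM_bounded V1 V2 V3 V4 (g : T -> R) (K : R) :
  L4 V1 -> L4 V2 -> L4 V3 -> L4 V4 ->
  measurable_fun setT g -> (forall w, `|g w| <= K) ->
  integ (fun w => V1 w * V2 w * V3 w * V4 w * g w).
Proof.
move=> h1 h2 h3 h4 mg gK.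
by apply: (integrable_mulr_bounded _ mg gK); exact: integrable_fourM.
Qed.

(** Weak form of the conditional variance of a row sum given [x]. The factor [y ^+ 2] leaves room
    for the outer [x n] of an increment of [rowquad]. *)
Lemma rowsum_sqrM i k y (g : T -> R) (K : R) : L4 y ->
  measurable_fun setT g -> (forall w, `|g w| <= K) ->
  (forall j, avoids entries (inr (i, j)) g) ->
  (forall j, avoids entries (inr (i, j)) y) ->
  \int[P]_w (rowsum i k w ^+ 2 * (y w ^+ 2 * g w)) =
  \int[P]_w ((\sum_(j < k) x j w ^+ 2) * (y w ^+ 2 * g w)).
Proof.
move=> y4 mg gK ag ay.
have iy V U : L4 V -> L4 U -> integ (fun w => V w * U w * (y w ^+ 2 * g w)).
  move=> V4 U4; rewrite (_ : (fun w => _) = fun w => V w * U w * y w * y w * g w).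
    exact: (integrable_fourM_bounded V4 U4 y4 y4 mg gK).
  by apply/funext => w; ring.
have iy2 V : L4 V -> integ (fun w => V w ^+ 2 * (y w ^+ 2 * g w)).
  by move=> V4; have := iy _ _ V4 V4; under eq_fun do rewrite -expr2.
elim: k => [|k ih].
  by apply: eq_Rintegral => w _; rewrite /rowsum !big_ord0 expr0n.
have [r4 _] := rowsum_fourth i k.
under eq_Rintegral do rewrite /rowsum big_ord_recr /= -/(rowsum i k _).
rewrite integral_sqr_incrM.
- rewrite ih -RintegralD//.
  + by apply: eq_Rintegral => w _; rewrite big_ord_recr /= -mulrDl.
  + rewrite (_ : (fun w => _) =
      fun w => \sum_(j < k) x j w ^+ 2 * (y w ^+ 2 * g w)).
      apply: integrable_real_sum => j _; apply: iy2; exact: fourth_integrable_x.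
    by apply/funext => w; rewrite mulr_suml.
  + by apply: iy2; exact: fourth_integrable_x.
- by apply: avoids_s_rowsum; rewrite leqnn orbT.
- exact: avoids_s_x.
- by apply: avoidsM => //; exact: avoidsX.
- exact: iy2.
- by apply: iy => //; exact: fourth_integrable_x.
- by apply: iy2; exact: fourth_integrable_x.
Qed.

(** The conditional variance of [rowquad i n] given [x], the same for every row. *)
Definition pairsum (n : nat) (w : T) : R :=
  \sum_(k < n) (\sum_(j < k) x j w ^+ 2) * x k w ^+ 2.

Lemma pairsum_integrable n : integ (pairsum n).
Proof.
apply: integrable_real_sum => k _.
rewrite (_ : (fun w => _) = fun w => \sum_(j < k) x j w * x j w * x k w * x k w).
  by apply: integrable_real_sum => j _; apply: integrable_fourM.
by apply/funext => w; rewrite mulr_suml; apply: eq_bigr => j _; ring.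
Qed.

(** Weak form of the statement that [q_i^2] has conditional expectation [pairsum n] given [x] and
    the other rows: it is tested against bounded [g] free of row [i]. *)
Lemma rowquad_sqrM i n (g : T -> R) (K : R) :
  measurable_fun setT g -> (forall w, `|g w| <= K) ->
  (forall j, avoids entries (inr (i, j)) g) ->
  \int[P]_w (rowquad i n w ^+ 2 * g w) = \int[P]_w (pairsum n w * g w).
Proof.
move=> mg gK ag.
have ig V U : L4 V -> L4 U -> integ (fun w => V w * U w * g w).
  move=> V4 U4; apply: (integrable_mulr_bounded _ mg gK); exact: integrable_twoM.
have ig2 V : L4 V -> integ (fun w => V w ^+ 2 * g w).
  by move=> V4; have := ig _ _ V4 V4; under eq_fun do rewrite -expr2.
elim: n => [|n ih].
  by apply: eq_Rintegral => w _; rewrite /rowquad /pairsum !big_ord0 expr0n.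
have [q4 _] := rowquad_fourth i n.
have [xr4 _ _] := rowquad_incr i n.
under eq_Rintegral do rewrite /rowquad big_ord_recr /= -/(rowquad i n _) -mulrA.
rewrite (@integral_sqr_incrM i n (rowquad i n) (fun w => x n w * rowsum i n w) g).
- rewrite ih.
  have -> : \int[P]_w ((x n w * rowsum i n w) ^+ 2 * g w) =
      \int[P]_w (rowsum i n w ^+ 2 * (x n w ^+ 2 * g w)).
    by apply: eq_Rintegral => w _; ring.
  rewrite (@rowsum_sqrM i n (x n) g K)//; last by move=> j; exact: avoids_s_x.
  rewrite -RintegralD//.
  + by apply: eq_Rintegral => w _; rewrite /pairsum big_ord_recr /= mulrDl mulrA.
  + by apply: (integrable_mulr_bounded _ mg gK); exact: pairsum_integrable.
  + rewrite (_ : (fun w => _) =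
      fun w => \sum_(j < n) x j w * x j w * x n w * x n w * g w).
      apply: integrable_real_sum => j _.
      by apply: (integrable_fourM_bounded _ _ _ _ mg gK).
    by apply/funext => w; rewrite mulr_suml; apply: eq_bigr => j _; ring.
- by apply: avoids_s_rowquad; rewrite leqnn orbT.
- apply: avoidsM; first exact: avoids_s_x.
  by apply: avoids_s_rowsum; rewrite leqnn orbT.
- exact: ag.
- exact: ig2.
- exact: ig.
- exact: ig2.
Qed.

(** Weak form of the conditional centring of [q_i]. Integrability is asked term by term because [g]
    is not always bounded: it involves a cube of partial sums in [stein_sum_fourth]. *)
Lemma rowquadM_eq0 i n (g : T -> R) :
  (forall k, integ (fun w => x k w * rowsum i k w * g w)) ->
  (forall j, avoids entries (inr (i, j)) g) ->
  \int[P]_w (rowquad i n w * g w) = 0.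
Proof.
move=> ig ag.
have h (k : 'I_n) : integ (fun w => s i k w * (x k w * rowsum i k w * g w)) /\
    \int[P]_w (s i k w * (x k w * rowsum i k w * g w)) = 0.
  apply: integral_sM => //.
  apply: avoidsM => //; apply: avoidsM; first exact: avoids_s_x.
  by apply: avoids_s_rowsum; rewrite leqnn orbT.
transitivity (\int[P]_w
    (\sum_(k < n) s i k w * (x k w * rowsum i k w * g w))).
  by apply: eq_Rintegral => w _; rewrite mulr_suml; apply: eq_bigr => k _; ring.
rewrite Rintegral_sum; last by move=> k _; case: (h k).
by apply: big1 => k _; case: (h k).
Qed.

(** The summands are independent and centred; the variance [kx - 1] of each is replaced by the
    cruder [kx + 1]. *)
Lemma sum_sqr_sub1 n :
  integ (fun w => (\sum_(j < n) (x j w ^+ 2 - 1)) ^+ 2) /\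
  \int[P]_w ((\sum_(j < n) (x j w ^+ 2 - 1)) ^+ 2) <= (kx + 1) * n%:R.
Proof.
have mV j : measurable_fun setT (fun w => x j w ^+ 2 - 1).
  by apply: measurable_funB => //; exact: measurable_funX.
have ib j : integ (fun w => x j w ^+ 4 + 1).
  by apply: integrable_realD => //; exact: integrable_real_cst.
have bnd j w : `|(x j w ^+ 2 - 1) ^+ 2| <= x j w ^+ 4 + 1.
  rewrite ger0_norm ?sqr_ge0//; set a := x j w.
  rewrite -subr_ge0 (_ : _ + 1 - _ = 2 * a ^+ 2); last by ring.
  by rewrite mulr_ge0// sqr_ge0.
have iV j : integ (fun w => (x j w ^+ 2 - 1) ^+ 2).
  by apply: (integrable_le_norm _ (ib j)) => //; exact: measurable_funX.
have := @second_moment_orthogonal _ _ _ P _ (index_enum 'I_n)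
  (fun j w => x j w ^+ 2 - 1) (kx + 1) (index_enum_uniq _) (fun j => mV j)
  (fun j => iV j).
have -> : size (index_enum 'I_n) = n by rewrite /index_enum -enumT size_enum_ord.
apply.
- move=> j; apply: (le_trans (ler_norm _)).
  apply: (le_trans (Rintegral_norm_le (iV j) (ib j) (bnd j))).
  rewrite RintegralD//; last exact: integrable_real_cst.
  by rewrite Ex4 Rintegral_prob_cst.
- move=> j k jk.
  have := @Rintegral_avoidsM _ _ _ _ _ entries indep (inl (j : nat)) (fun v => v ^+ 2 - 1)
    (fun w => x k w ^+ 2 - 1).
  case.
  + by apply: measurable_funB => //; exact: exprn_measurable.
  + apply: avoidsD; last exact: avoids_cst.
    by apply: avoidsX; exact: avoids_x_x.
  + apply: integrable_realB; last exact: integrable_real_cst.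
    exact: (fourth_integrable_sqr (fourth_integrable_x j)).
  + apply: integrable_realB; last exact: integrable_real_cst.
    exact: (fourth_integrable_sqr (fourth_integrable_x k)).
  move=> _ /= ->; rewrite [X in _ * X]RintegralB//.
  + by rewrite Ex2 Rintegral_prob_cst subrr mulr0.
  + exact: (fourth_integrable_sqr (fourth_integrable_x k)).
  + exact: integrable_real_cst.
Qed.

Definition diagsum (m n : nat) (w : T) : R :=
  \sum_(ij : 'I_m * 'I_n) (s ij.1 ij.2 w ^+ 2 - 1) * x ij.2 w ^+ 2.

(** Summands in one column share [x j], yet any two are orthogonal because [s i j ^+ 2 - 1] is
    centred and independent of the rest. So the bound grows like [m * n]. *)
Lemma diagsum_sqr m n : integ (fun w => diagsum m n w ^+ 2) /\
  \int[P]_w (diagsum m n w ^+ 2) <= (ks + 1) * kx * (m * n)%:R.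
Proof.
pose V (ij : 'I_m * 'I_n) w := (s ij.1 ij.2 w ^+ 2 - 1) * x ij.2 w ^+ 2.
have mV ij : measurable_fun setT (V ij).
  apply: measurable_funM; last exact: measurable_funX.
  by apply: measurable_funB => //; exact: measurable_funX.
have i2 ij : integ (fun w => s (ij : 'I_m * 'I_n).1 ij.2 w ^+ 4 * x ij.2 w ^+ 4) /\
    \int[P]_w (s ij.1 ij.2 w ^+ 4 * x ij.2 w ^+ 4) = ks * kx.
  by rewrite -(Ex4 ij.2); apply: integral_s4M => //; apply: avoidsX; exact: avoids_s_x.
have ib ij : integ (fun w => s (ij : 'I_m * 'I_n).1 ij.2 w ^+ 4 * x ij.2 w ^+ 4 +
    x ij.2 w ^+ 4).
  by apply: integrable_realD => //; case: (i2 ij).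
have bnd ij w : `|V ij w ^+ 2| <= s ij.1 ij.2 w ^+ 4 * x ij.2 w ^+ 4 +
    x ij.2 w ^+ 4.
  rewrite ger0_norm ?sqr_ge0// /V; set a := x _ w; set b := s _ _ w.
  rewrite -subr_ge0 (_ : _ + _ - _ = 2 * (b * a ^+ 2) ^+ 2); last by ring.
  by rewrite mulr_ge0// sqr_ge0.
have iV ij : integ (fun w => V ij w ^+ 2).
  by apply: (integrable_le_norm _ (ib ij)) => //; exact: measurable_funX.
have := @second_moment_orthogonal _ _ _ P _ (index_enum ('I_m * 'I_n)%type)
  V ((ks + 1) * kx) (index_enum_uniq _) mV iV.
have -> : size (index_enum ('I_m * 'I_n)%type) = (m * n)%N.
  by rewrite /index_enum -enumT -cardE card_prod !card_ord.
apply.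
- move=> ij; apply: (le_trans (ler_norm _)).
  apply: (le_trans (Rintegral_norm_le (iV ij) (ib ij) (bnd ij))).
  rewrite RintegralD//; last by case: (i2 ij).
  by case: (i2 ij) => _ ->; rewrite Ex4 mulrDl mul1r.
- move=> [i j] [i' j'] ijij.
  pose G w := x j w ^+ 2 * V (i', j') w.
  have aG : avoids entries (inr (i : nat, j : nat)) G.
    apply: avoidsM; first by apply: avoidsX; exact: avoids_s_x.
    apply: avoidsM; last by apply: avoidsX; exact: avoids_s_x.
    apply: avoidsD; last exact: avoids_cst.
    apply: avoidsX; apply: avoids_s_s.
    by rewrite -negb_and; apply: contra ijij; rewrite xpair_eqE.
  have iG : integ G.
    apply: (@integrable_le_norm _ _ _ _ _ (fun w => x j w ^+ 4 + V (i', j') w ^+ 2)).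
    + by apply: measurable_funM => //; exact: measurable_funX.
    + exact: integrable_realD.
    + move=> w; rewrite /G; set a := x j w; set b := V _ w.
      rewrite (_ : a ^+ 4 = (a ^+ 2) ^+ 2); last by ring.
      set c := a ^+ 2.
      have := sqr_ge0 (c - b); have := sqr_ge0 (c + b).
      by rewrite !expr2 => h1 h2; rewrite ler_norml; apply/andP; split; nra.
  have [j1 E1] := integral_s2M aG iG.
  transitivity (\int[P]_w (s i j w ^+ 2 * G w - G w)).
    by apply: eq_Rintegral => w _; rewrite /G /V /=; ring.
  by rewrite RintegralB// E1 subrr.
Qed.

Lemma pairsum_double n w : 2 * pairsum n w =
  (\sum_(j < n) x j w ^+ 2) ^+ 2 - \sum_(j < n) x j w ^+ 4.
Proof.
rewrite /pairsum; elim: n => [|n ih]; first by rewrite !big_ord0 mulr0 expr0n subr0.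
by rewrite !big_ord_recr /= mulrDr ih; ring.
Qed.

(** A quantitative law of large numbers. With [a = A / n] and [b] the sum of the [x_j^4] over [n^2],
    the deviation is [- 2 a - a^2 + b]. The bound [2 |a| <= eta + a^2 / eta] takes the place of
    Cauchy-Schwarz. *)
Lemma pairsum_dev n (eta : R) : (0 < n)%N -> 0 < eta ->
  integ (fun w => `|1 - 2 * pairsum n w / n%:R ^+ 2|) /\
  \int[P]_w `|1 - 2 * pairsum n w / n%:R ^+ 2| <=
    eta + ((kx + 1) * (1 + eta^-1) + kx) / n%:R.
Proof.
move=> n0 eta0; set N := n%:R : R.
have N0 : 0 < N by rewrite ltr0n.
have [iA AE] := sum_sqr_sub1 n.
set A := fun w => \sum_(j < n) (x j w ^+ 2 - 1) in iA AE.
pose B w := \sum_(j < n) x j w ^+ 4.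
have iB : integ B by apply: integrable_real_sum.
have BE : \int[P]_w B w = kx * N.
  rewrite Rintegral_sum//; under eq_bigr do rewrite Ex4.
  by rewrite sumr_const card_ord mulr_natr.
have e0 : 0 < eta^-1 by rewrite invr_gt0.
have B0 w : 0 <= B w.
  by apply: sumr_ge0 => j _; rewrite (exprn_even_ge0 _ (isT : ~~ odd 4)).
pose G w := (eta + (1 + eta^-1) / N ^+ 2 * A w ^+ 2) + (N ^+ 2)^-1 * B w.
have i1 : integ (fun w => eta + (1 + eta^-1) / N ^+ 2 * A w ^+ 2).
  by apply: integrable_realD; [exact: integrable_real_cst|exact: integrable_realZ].
have iG : integ G by apply: integrable_realD => //; exact: integrable_realZ.
have le1 w : `|1 - 2 * pairsum n w / N ^+ 2| <= G w.
  have SE : \sum_(j < n) x j w ^+ 2 = N + A w.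
    by rewrite /A sumrB sumr_const card_ord -/N addrC subrK.
  rewrite pairsum_double SE -/(B w) /G.
  pose a := A w / N; pose b := B w / N ^+ 2.
  rewrite (_ : 1 - _ = - (2 * a) - a ^+ 2 + b); last first.
    by rewrite /a /b; field; rewrite gt_eqF.
  rewrite (_ : _ + _ = eta + (1 + eta^-1) * a ^+ 2 + b); last first.
    by rewrite /a /b; field; rewrite !gt_eqF.
  have b0 : 0 <= b by rewrite divr_ge0// exprn_ge0// ltW.
  have a20 := sqr_ge0 a.
  have h1 : 2 * a <= eta + eta^-1 * a ^+ 2.
    rewrite -subr_ge0 (_ : _ - _ = eta^-1 * (a - eta) ^+ 2).
      by rewrite mulr_ge0 ?sqr_ge0// ltW.
    by field; rewrite gt_eqF.
  have h2 : - (2 * a) <= eta + eta^-1 * a ^+ 2.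
    rewrite -subr_ge0 (_ : _ - _ = eta^-1 * (a + eta) ^+ 2).
      by rewrite mulr_ge0 ?sqr_ge0// ltW.
    by field; rewrite gt_eqF.
  rewrite mulrDl mul1r ler_norml; apply/andP; split; lra.
have iF : integ (fun w => `|1 - 2 * pairsum n w / N ^+ 2|).
  apply: integrable_norm; apply: integrable_realB; first exact: integrable_real_cst.
  rewrite (_ : (fun w => _) = fun w => (2 / N ^+ 2) * pairsum n w).
    by apply: integrable_realZ; exact: pairsum_integrable.
  by apply/funext => w; ring.
split => //.
apply: (@le_trans _ _ (\int[P]_w G w)); first by apply: le_Rintegral => // w _.
rewrite /G RintegralD//; last exact: integrable_realZ.
rewrite RintegralD//; last 2 first.
- exact: integrable_real_cst.
- exact: integrable_realZ.
rewrite !RintegralZl// Rintegral_prob_cst BE -addrA lerD2l.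
have := ler_wpM2l (_ : 0 <= (1 + eta^-1) / N ^+ 2) AE.
rewrite divr_ge0 ?sqr_ge0 ?addr_ge0 ?(ltW e0)// => /(_ isT) h.
apply: (le_trans (lerD h (lexx _))).
rewrite -/N le_eqVlt; apply/orP; left; apply/eqP; field.
by rewrite !gt_eqF.
Qed.

(** * Stein's method over the rows *)

Section stein_bound.
Variables (m n : nat) (rho : R).
Hypotheses (m0 : (0 < m)%N) (n0 : (0 < n)%N).
Hypothesis rho2 : rho ^+ 2 = 2 / (m%:R * n%:R ^+ 2).

(** Since [pairsum n] is close to [n^2 / 2], the hypothesis on [rho] gives each scaled row a
    conditional variance close to [1 / m]. *)
Definition scaled_row (i : nat) (w : T) : R := rho * rowquad i n w.
Definition stein_sum (w : T) : R := \sum_(i < m) scaled_row i w.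

Local Notation xi := scaled_row.
Local Notation W := stein_sum.
(* [rho ^+ 4] times the constant of [rowquad_fourth]. *)
Let C4 := 4 * (70 * 70) * kap ^+ 2.

Let M0 : 0 < m%:R :> R. Proof. by rewrite ltr0n. Qed.
Let N0 : 0 < n%:R :> R. Proof. by rewrite ltr0n. Qed.

Let C40 : 0 <= C4. Proof. by rewrite mulr_ge0// sqr_ge0. Qed.

Lemma scaled_row_fourth i : L4 (xi i) /\ \int[P]_w (xi i w ^+ 4) <= C4 / m%:R ^+ 2.
Proof.
have [q4 qE] := rowquad_fourth i n.
split; first exact: fourth_integrableZ.
under eq_Rintegral do rewrite exprMn.
rewrite RintegralZl//; last by case: q4.
have -> : rho ^+ 4 = (rho ^+ 2) ^+ 2 by ring.
rewrite rho2.
have := ler_wpM2l (sqr_ge0 (2 / (m%:R * n%:R ^+ 2))) qE.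
move=> /le_trans; apply; rewrite le_eqVlt; apply/orP; left; apply/eqP.
by rewrite /C4; field; rewrite !gt_eqF.
Qed.

Lemma avoids_scaled_row i i' j : i != i' -> avoids entries (inr (i, j)) (xi i').
Proof.
move=> ii'; apply: avoidsM; first exact: avoids_cst.
by apply: avoids_s_rowquad; rewrite ii'.
Qed.

(** The third use of [fourth_moment_sum], now along the rows: [q_i] is centred given [x] and the
    earlier rows. *)
Lemma stein_sum_fourth : L4 W /\ \int[P]_w (W w ^+ 4) <= 70 * C4.
Proof.
have S4 k : L4 (fun w => \sum_(i < k) xi i w).
  by apply: fourth_integrable_sum => i _; case: (scaled_row_fourth i).
split; first exact: S4.
have -> : 70 * C4 = 70 * (C4 / m%:R ^+ 2) * m%:R ^+ 2 by field; rewrite gt_eqF.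
apply: (@fourth_moment_sum _ _ _ _ xi).
- by move=> i _; case: (scaled_row_fourth i).
- by move=> i _; case: (scaled_row_fourth i).
- move=> i _.
  transitivity (\int[P]_w (rowquad i n w * (rho * (\sum_(j < i) xi j w) ^+ 3))).
    by apply: eq_Rintegral => w _; rewrite /xi; ring.
  apply: rowquadM_eq0 => k.
    rewrite (_ : (fun w => _) = fun w => rho * (x k w * rowsum i k w *
      (\sum_(j < i) xi j w) * (\sum_(j < i) xi j w) * (\sum_(j < i) xi j w))).
      apply: integrable_realZ; apply: integrable_fourM => //.
      by case: (rowquad_incr i k).
    by apply/funext => w; ring.
  apply: avoidsM; first exact: avoids_cst.
  apply: avoidsX; apply: avoids_sum => j _; apply: avoids_scaled_row.
  by rewrite gtn_eqF.
Qed.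


Variables (f f' : R -> R) (K : R).
Hypothesis df : forall y : R, is_derive y 1 f (f' y).
Hypotheses (mf : measurable_fun setT f) (mf' : measurable_fun setT f').
Hypotheses (fK : forall y, `|f y| <= K) (f'K : forall y, `|f' y| <= K).
Hypothesis lf : forall y y', `|f' y - f' y'| <= K * (1 + `|y|) * `|y - y'|.

Let K0 : 0 <= K. Proof. exact: le_trans (fK 0). Qed.

Let delta := \int[P]_w `|1 - 2 * pairsum n w / n%:R ^+ 2|.

(* Leave-one-out: [W w - xi i w] does not involve row [i] of [s], so that
   replacing [W] by it kills the linear term and turns [xi i ^+ 2] into its
   conditional expectation given [x]. *)
Lemma stein_row (i : 'I_m) (eta : R) : 0 < eta ->
  integ (fun w => f' (W w) / m%:R - xi i w * f (W w)) /\
  `|\int[P]_w (f' (W w) / m%:R - xi i w * f (W w))| <=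
  K / m%:R * (delta + 48 * 48 * (C4 + 1) * ((eta * m%:R)^-1 + eta)).
Proof.
move=> eta0.
have [W4 WE] := stein_sum_fourth.
have [z4 zE] := scaled_row_fourth i.
pose v w := W w - xi i w.
have v4 : L4 v by exact: fourth_integrableB.
(* [v] is the sum over the other rows, so it is free of every entry of row [i], though not of
   [x]. *)
have av j : avoids entries (inr (i : nat, j)) v.
  rewrite (_ : v = fun w => \sum_(k < m | k != i) xi k w).
    apply: avoids_sum => k ki; apply: avoids_scaled_row.
    by rewrite eq_sym.
  by apply/funext => w; rewrite /v /W (bigD1 i)//= addrC addrK.
have mv : measurable_fun setT v by case: v4.
have mW : measurable_fun setT W by case: W4.
have mfv : measurable_fun setT (fun w => f (v w)) by exact: measurableT_comp.
have mf'v : measurable_fun setT (fun w => f' (v w)) by exact: measurableT_comp.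
have mfW : measurable_fun setT (fun w => f (W w)) by exact: measurableT_comp.
have mf'W : measurable_fun setT (fun w => f' (W w)) by exact: measurableT_comp.
have bnd1 (g : R -> R) (u : T -> R) : measurable_fun setT (fun w => g (u w)) ->
    (forall y, `|g y| <= K) -> integ (fun w => g (u w)).
  by move=> mg gK; apply: (integrable_le_norm mg (integrable_real_cst P K)).
have iz := fourth_integrable_integrable z4.
have iz2 := fourth_integrable_sqr z4.
have izfv : integ (fun w => xi i w * f (v w)).
  exact: (integrable_mulr_bounded iz mfv (fun w => fK _)).
have izfW : integ (fun w => xi i w * f (W w)).
  exact: (integrable_mulr_bounded iz mfW (fun w => fK _)).
have iz2f' : integ (fun w => xi i w ^+ 2 * f' (v w)).
  exact: (integrable_mulr_bounded iz2 mf'v (fun w => f'K _)).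
have if'v : integ (fun w => f' (v w)) by exact: bnd1.
have if'W : integ (fun w => f' (W w)) by exact: bnd1.
have if'vm : integ (fun w => f' (v w) / m%:R).
  by have := integrable_realZ m%:R^-1 if'v; under eq_fun do rewrite mulrC.
have if'Wm : integ (fun w => f' (W w) / m%:R).
  by have := integrable_realZ m%:R^-1 if'W; under eq_fun do rewrite mulrC.
have iterm : integ (fun w => f' (W w) / m%:R - xi i w * f (W w)).
  exact: integrable_realB.
split=> //.
have Ezf : \int[P]_w (xi i w * f (v w)) = 0.
  transitivity (\int[P]_w (rho * (rowquad i n w * f (v w)))).
    by apply: eq_Rintegral => w _; rewrite /xi; ring.
  have [q4 _] := rowquad_fourth i n.
  rewrite RintegralZl//; last first.
    apply: (integrable_mulr_bounded _ mfv (fun w => fK _)).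
    exact: fourth_integrable_integrable.
  rewrite rowquadM_eq0 ?mulr0//.
    move=> k; apply: (integrable_mulr_bounded _ mfv (fun w => fK _)).
    by apply: fourth_integrable_integrable; case: (rowquad_incr i k).
  by move=> j; exact: avoids_comp.
have iPf : integ (fun w => pairsum n w * f' (v w)).
  by apply: (integrable_mulr_bounded _ mf'v (fun w => f'K _)); exact: pairsum_integrable.
have Ez2f : \int[P]_w (xi i w ^+ 2 * f' (v w)) =
    rho ^+ 2 * \int[P]_w (pairsum n w * f' (v w)).
  have [q4 _] := rowquad_fourth i n.
  transitivity (\int[P]_w (rho ^+ 2 * (rowquad i n w ^+ 2 * f' (v w)))).
    by apply: eq_Rintegral => w _; rewrite /xi; ring.
  rewrite RintegralZl//; last first.
    apply: (integrable_mulr_bounded _ mf'v (fun w => f'K _)).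
    exact: fourth_integrable_sqr.
  congr (_ * _); apply: (rowquad_sqrM _ mf'v (fun w => f'K _)) => j.
  exact: avoids_comp.
(* Besides [rest], which holds both Taylor remainders, the term splits into a variance discrepancy,
   of order [delta / m], and [xi i * f v], of mean [0]. *)
pose rest w := (f' (W w) - f' (v w)) / m%:R -
  xi i w * (f (W w) - f (v w) - xi i w * f' (v w)).
have restE w : f' (W w) / m%:R - xi i w * f (W w) =
    (f' (v w) / m%:R - xi i w ^+ 2 * f' (v w)) - xi i w * f (v w) + rest w.
  by rewrite /rest; ring.
have irest : integ rest.
  rewrite (_ : rest = fun w => (f' (W w) / m%:R - xi i w * f (W w)) -
      (f' (v w) / m%:R - xi i w ^+ 2 * f' (v w) - xi i w * f (v w))).
    by apply: integrable_realB => //; do 2 apply: integrable_realB => //.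
  by apply/funext => w; rewrite restE; ring.
have imain : integ (fun w => f' (v w) / m%:R - xi i w ^+ 2 * f' (v w)).
  exact: integrable_realB.
under eq_Rintegral do rewrite restE.
rewrite RintegralD//; last exact: integrable_realB.
rewrite RintegralB// Ezf subr0.
apply: (le_trans (ler_normD _ _)); rewrite mulrDr; apply: lerD.
  rewrite RintegralB// Ez2f.
  have -> : \int[P]_w (f' (v w) / m%:R) - rho ^+ 2 * \int[P]_w (pairsum n w * f' (v w)) =
     \int[P]_w (m%:R^-1 * ((1 - 2 * pairsum n w / n%:R ^+ 2) * f' (v w))).
    rewrite rho2 -RintegralZl// -RintegralB//; last exact: integrable_realZ.
    by apply: eq_Rintegral => w _; field; rewrite !gt_eqF.
  (* The weight [1] is arbitrary: only integrability is taken from this instance. *)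
  have [id _] := @pairsum_dev n 1 n0 ltr01.
  have ih : integ (fun w => (1 - 2 * pairsum n w / n%:R ^+ 2) * f' (v w)).
    apply: (integrable_mulr_bounded _ mf'v (fun w => f'K _)).
    apply: integrable_realB; first exact: integrable_real_cst.
    rewrite (_ : (fun w => _) = fun w => (2 / n%:R ^+ 2) * pairsum n w).
      by apply: integrable_realZ; exact: pairsum_integrable.
    by apply/funext => w; ring.
  rewrite mulrAC -mulrA mulrA /delta -RintegralZl//.
  rewrite -[leRHS]mulrC -RintegralZl//; last exact: integrable_realZ.
  apply: Rintegral_norm_le.
  - exact: integrable_realZ.
  - by apply: integrable_realZ; exact: integrable_realZ.
  move=> w; rewrite !normrM ger0_norm ?invr_ge0 ?ler0n//.
  by rewrite ler_wpM2l ?invr_ge0// mulrC ler_wpM2r.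
pose H w := xi i w ^+ 4 * (eta^-1 + eta * m%:R) + (eta * m%:R ^+ 2)^-1 +
  4 * (eta / m%:R) * (1 + v w ^+ 4).
have [_ iv4] := v4; have [_ iW4] := W4; have [_ iz4] := z4.
have i1v4 : integ (fun w => 1 + v w ^+ 4).
  by apply: integrable_realD => //; exact: integrable_real_cst.
have izH : integ (fun w => xi i w ^+ 4 * (eta^-1 + eta * m%:R)).
  by have := integrable_realZ (eta^-1 + eta * m%:R) iz4; under eq_fun do rewrite mulrC.
have izH2 : integ (fun w => xi i w ^+ 4 * (eta^-1 + eta * m%:R) + (eta * m%:R ^+ 2)^-1).
  by apply: integrable_realD => //; exact: integrable_real_cst.
have iH : integ H.
  by apply: integrable_realD => //; exact: integrable_realZ.
(* [8] is the convexity constant for [(W - xi i) ^ 4], and [71] adds [70] for [W] and [1] for the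
   single row. *)
have Ev4 : \int[P]_w (v w ^+ 4) <= 8 * 71 * C4.
  apply: (@le_trans _ _ (\int[P]_w (8 * (W w ^+ 4 + xi i w ^+ 4)))).
    apply: le_Rintegral => //.
      by apply: integrable_realZ; exact: integrable_realD.
    move=> w _; rewrite /v; set a := W w; set b := xi i w.
    rewrite -subr_ge0 (_ : _ - _ = (a + b) ^+ 2 * (7 * (a ^+ 2 + b ^+ 2) -
      10 * (a * b))); last by ring.
    apply: mulr_ge0; first exact: sqr_ge0.
    have := sqr_ge0 (a - b); have := sqr_ge0 a; have := sqr_ge0 b.
    by rewrite !expr2; nra.
  rewrite RintegralZl//; last exact: integrable_realD.
  rewrite RintegralD//.
  have : C4 / m%:R ^+ 2 <= C4.
    rewrite ler_pdivrMr ?exprn_gt0// ler_peMr// exprn_ege1// ler1n//.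
  by move: WE zE C40; lra.
apply: (@le_trans _ _ (K * \int[P]_w H w)).
  rewrite -RintegralZl//; apply: Rintegral_norm_le => //.
    exact: integrable_realZ.
  move=> w; apply: (le_trans _ (ler_wpM2l K0
    (stein_remainder_bound (v w) (xi i w) eta0 M0))).
  have Wv : W w = v w + xi i w by rewrite /v subrK.
  rewrite /rest Wv.
  apply: (le_trans (ler_normB _ _)); rewrite addrC [leRHS]mulrDr; apply: lerD.
    rewrite normrM (_ : K * _ = `|xi i w| * (K * (1 + `|v w|) * xi i w ^+ 2)).
      by apply: ler_wpM2l => //; exact: taylor1_bound.
    by rewrite -(real_normK (num_real (xi i w))); ring.
  rewrite normrM [X in _ * X <= _]ger0_norm ?invr_ge0 ?ler0n// !mulrA ler_wpM2r ?invr_ge0//.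
  rewrite distrC (le_trans (lf _ _))//.
  by rewrite opprD addrA subrr sub0r normrN.
rewrite -mulrA; apply: ler_wpM2l => //.
rewrite /H RintegralD//; last exact: integrable_realZ.
rewrite RintegralD//; last exact: integrable_real_cst.
rewrite RintegralZl// RintegralZr// RintegralD//; last exact: integrable_real_cst.
rewrite !Rintegral_prob_cst.
have e0 : 0 < eta^-1 by rewrite invr_gt0.
have u0 : 0 < m%:R^-1 :> R by rewrite invr_gt0.
have b1 : \int[P]_w xi i w ^+ 4 * (eta^-1 + eta * m%:R) <=
    C4 / m%:R ^+ 2 * (eta^-1 + eta * m%:R).
  apply: ler_wpM2r => //.
  by rewrite addr_ge0 ?mulr_ge0// ltW.
have b2 : 4 * (eta / m%:R) * (1 + \int[P]_w v w ^+ 4) <=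
    4 * (eta / m%:R) * (1 + 8 * 71 * C4).
  apply: ler_wpM2l; last by rewrite lerD2l.
  by rewrite mulr_ge0// divr_ge0 ?ltW.
apply: (le_trans (lerD (lerD b1 (lexx _)) b2)).
rewrite -subr_ge0.
(* [48 * 48 = 2304] exceeds [1 + 4 * 8 * 71 = 2273], the coefficient of [C4 * eta / m] collected
   above. *)
rewrite (_ : _ - _ = ((48 * 48 - 1) * (C4 + 1)) * (eta^-1 / m%:R ^+ 2) +
   (31 * C4 + 46 * 50) * (eta / m%:R)); last first.
  by field; rewrite !gt_eqF.
have c1 : 0 <= 48 * 48 - 1 :> R by lra.
have p1 : 0 <= eta^-1 / m%:R ^+ 2 by rewrite divr_ge0 ?exprn_ge0// ltW.
have p2 : 0 <= eta / m%:R by rewrite divr_ge0// ltW.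
by rewrite addr_ge0// mulr_ge0// ?mulr_ge0// addr_ge0// mulr_ge0.
Qed.

(** [f' (W)] is shared out in [m] equal parts, one per row, to match the row variances [1 / m]. *)
Lemma stein_sum_bound (eta : R) : 0 < eta ->
  integ (fun w => f' (W w) - W w * f (W w)) /\
  `|\int[P]_w (f' (W w) - W w * f (W w))| <=
  K * (delta + 48 * 48 * (C4 + 1) * ((eta * m%:R)^-1 + eta)).
Proof.
move=> eta0.
have E : (fun w => f' (W w) - W w * f (W w)) =
    (fun w => \sum_(i < m) (f' (W w) / m%:R - xi i w * f (W w))).
  apply/funext => w; rewrite sumrB sumr_const card_ord -mulr_suml -/(W w).
  by congr (_ - _); rewrite -[RHS]mulr_natr divfK// gt_eqF.
rewrite E; split.
  by apply: integrable_real_sum => i _; case: (stein_row i eta0).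
rewrite Rintegral_sum; last by move=> i _; case: (stein_row i eta0).
apply: (le_trans (ler_norm_sum _ _ _)).
apply: (@le_trans _ _ (\sum_(i < m)
    K / m%:R * (delta + 48 * 48 * (C4 + 1) * ((eta * m%:R)^-1 + eta)))).
  by apply: ler_sum => i _; case: (stein_row i eta0).
rewrite sumr_const card_ord -mulr_natr le_eqVlt; apply/orP; left; apply/eqP.
by field; rewrite !gt_eqF.
Qed.

End stein_bound.

Lemma rowsum_sqr i n w : rowsum i n w ^+ 2 =
  2 * rowquad i n w + \sum_(j < n) (s i j w * x j w) ^+ 2.
Proof.
elim: n => [|n ih].
  by rewrite /rowsum /rowquad !big_ord0 expr0n mulr0 addr0.
rewrite /rowsum /rowquad !big_ord_recr /= -/(rowsum i n w) -/(rowquad i n w).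
by rewrite sqrrD ih; ring.
Qed.

Lemma SX_normsq_decomp m n w :
  SX_normsq (fun j => x j) (fun i j => s i j) m n w - (m * n)%:R =
  2 * (\sum_(i < m) rowquad i n w) + diagsum m n w +
  m%:R * \sum_(j < n) (x j w ^+ 2 - 1).
Proof.
have -> : SX_normsq (fun j => x j) (fun i j => s i j) m n w =
    \sum_(i < m) rowsum i n w ^+ 2.
  apply: eq_bigr => i _; congr (_ ^+ 2); rewrite mxE.
  by apply: eq_bigr => j _; rewrite !mxE.
have -> : diagsum m n w = \sum_(i < m) \sum_(j < n)
    ((s i j w ^+ 2 - 1) * x j w ^+ 2).
  by rewrite /diagsum pair_bigA.
have -> : m%:R * (\sum_(j < n) (x j w ^+ 2 - 1)) =
    \sum_(i < m) (\sum_(j < n) x j w ^+ 2 - n%:R) :> R.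
  by rewrite sumr_const card_ord mulr_natl sumrB sumr_const card_ord.
have -> : (m * n)%:R = \sum_(i < m) n%:R :> R.
  by rewrite sumr_const card_ord natrM mulr_natl.
rewrite mulr_sumr -sumrB -!big_split /=; apply: eq_bigr => i _.
rewrite rowsum_sqr.
have -> : \sum_(j < n) (s i j w * x j w) ^+ 2 =
    \sum_(j < n) ((s i j w ^+ 2 - 1) * x j w ^+ 2) + \sum_(j < n) x j w ^+ 2.
  by rewrite -big_split /=; apply: eq_bigr => j _; ring.
by rewrite !addrA.
Qed.

Let C4 := 4 * (70 * 70) * kap ^+ 2.
Let C40 : 0 <= C4. Proof. by rewrite mulr_ge0// sqr_ge0. Qed.

(** * Error bounds for Lipschitz test functions *)

Section test_function.
Variables (h : R -> R) (L : R).
Hypothesis L0 : 0 <= L.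
Hypothesis h01 : forall y, 0 <= h y <= 1.
Hypothesis hL : forall y y', `|h y - h y'| <= L * `|y - y'|.
Hypothesis mh : measurable_fun setT h.

Let ihc (V : T -> R) : measurable_fun setT V -> integ (fun w => h (V w)).
Proof.
move=> mV; apply: (integrable_le_norm _ (integrable_real_cst P 1)).
  exact: measurableT_comp.
by move=> w; case/andP: (h01 (V w)) => ? ?; rewrite ger0_norm.
Qed.

(** One [eta] serves both in [pairsum_dev] and in the Stein remainder; [eta <= 1] lets [1 / n] be
    absorbed into [1 / (eta * n)]. The constant is fixed before [m], [n] and [eta]. *)
Lemma test_function_stein : exists2 C1 : R, 0 <= C1 &
  forall (m n : nat) (rho eta : R), (0 < m)%N -> (0 < n)%N ->
    rho ^+ 2 = 2 / (m%:R * n%:R ^+ 2) -> 0 < eta -> eta <= 1 ->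
    `|\int[P]_w h (stein_sum m n rho w) - normal_mean h| <=
      C1 * (eta + eta^-1 * (m%:R^-1 + n%:R^-1)).
Proof.
have [f [f' [K [df [mf mf'] [fK f'K] lf fE]]]] := stein_solution L0 h01 hL.
have K0 : 0 <= K by exact: le_trans (fK 0).
have kx0 : 0 <= kx by apply: le_trans kx_ge1.
pose Q := 48 * 48 * (C4 + 1).
have Q0 : 0 <= Q by rewrite mulr_ge0// addr_ge0.
exists (K * (3 * kx + 3 + Q)); first by rewrite mulr_ge0// !addr_ge0// mulr_ge0.
move=> m n rho eta m0 n0 rho2 eta0 eta1.
have [iS SB] := stein_sum_bound m0 n0 rho2 df mf mf' fK f'K lf eta0.
have [_ dev] := pairsum_dev n0 eta0.
have [W4 _] := stein_sum_fourth m0 n0 rho2.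
have -> : \int[P]_w h (stein_sum m n rho w) - normal_mean h =
    \int[P]_w (f' (stein_sum m n rho w) - stein_sum m n rho w * f (stein_sum m n rho w)).
  under [in RHS]eq_Rintegral do rewrite fE.
  rewrite RintegralB//; last exact: integrable_real_cst.
    by rewrite Rintegral_prob_cst.
  by apply: ihc; case: W4.
apply: (le_trans SB); rewrite -[leRHS]mulrA; apply: ler_wpM2l => //.
apply: (le_trans (lerD dev (lexx _))); rewrite -/C4 -/Q.
set a := m%:R^-1 : R; set b := n%:R^-1 : R; set e := eta^-1.
have a0 : 0 < a by rewrite invr_gt0 ltr0n.
have b0 : 0 < b by rewrite invr_gt0 ltr0n.
have e1 : 1 <= e by rewrite invf_ge1.
have -> : (eta * m%:R)^-1 = e * a by rewrite invfM.
have eb : b <= e * b by rewrite ler_peMl// ltW.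
have eb0 : 0 <= e * b by apply: le_trans eb; rewrite ltW.
have ea0 : 0 <= e * a by rewrite mulr_ge0// ltW// (lt_le_trans ltr01).
have h1 : kx * b <= kx * (e * b) by rewrite ler_wpM2l.
have p1 : 0 <= kx * (e * a) by rewrite mulr_ge0.
have p2 : 0 <= kx * eta by rewrite mulr_ge0// ltW.
have p3 : 0 <= Q * (e * b) by rewrite mulr_ge0.
rewrite -subr_ge0.
rewrite (_ : _ - _ = 3 * (kx * eta) + 2 * eta + 3 * (kx * (e * a)) + 3 * (e * a) +
  (e * b - b) + e * b + 2 * (kx * (e * b) - kx * b) + Q * (e * b)); last by ring.
lra.
Qed.

(** AM-GM with weight [eta], instead of Cauchy-Schwarz, turns a second moment into a first one
    without square roots of integrals. *)
Lemma sqr_avg_bound (D : T -> R) (K b eta : R) : measurable_fun setT D ->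
  0 < b -> 0 < eta ->
  integ (fun w => D w ^+ 2) -> \int[P]_w (D w ^+ 2) <= K ->
  integ (fun w => `|D w| / b) /\
  \int[P]_w (`|D w| / b) <= eta + eta^-1 * (K / b ^+ 2).
Proof.
move=> mD b0 eta0 iD DK.
have iG : integ (fun w => eta + eta^-1 / b ^+ 2 * D w ^+ 2).
  by apply: integrable_realD; [exact: integrable_real_cst|exact: integrable_realZ].
have le w : `|D w| / b <= eta + eta^-1 / b ^+ 2 * D w ^+ 2.
  rewrite -(real_normK (num_real (D w))); set a := `|D w|.
  rewrite -subr_ge0 (_ : _ - _ = eta^-1 * (eta - a / b / 2) ^+ 2 +
    eta^-1 * (a / b) ^+ 2 * (3 / 4)); last by field; rewrite !gt_eqF.
  have e0 : 0 <= eta^-1 by rewrite invr_ge0 ltW.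
  have := mulr_ge0 e0 (sqr_ge0 (eta - a / b / 2)).
  have := mulr_ge0 e0 (sqr_ge0 (a / b)).
  lra.
have iN : integ (fun w => `|D w| / b).
  apply: (integrable_le_norm _ iG).
    apply: measurable_funM => //; exact: measurableT_comp.
  by move=> w; rewrite ger0_norm// divr_ge0// ltW.
split => //.
apply: (@le_trans _ _ (\int[P]_w (eta + eta^-1 / b ^+ 2 * D w ^+ 2))).
  by apply: le_Rintegral.
rewrite RintegralD//; last 2 first.
- exact: integrable_real_cst.
- exact: integrable_realZ.
rewrite RintegralZl// Rintegral_prob_cst lerD2l.
by rewrite [K / _]mulrC mulrA ler_wpM2l// divr_ge0 ?invr_ge0 ?sqr_ge0// ltW.
Qed.

(** Here [b] is the leading part of the normalisation and [r] the actual one. [A] is compared with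
    [W] in mean, through [h] being Lipschitz, and [W] with the normal law by Stein's method. *)
Lemma test_function_error : exists2 C : R, 0 <= C &
  forall (m n : nat) (r : R), (0 < m)%N -> (0 < n)%N -> 0 <= r ->
    let b := Num.sqrt (2 * (m * n ^ 2)%:R) in
    let tau := m%:R^-1 + n%:R^-1 + m%:R / n%:R : R in
    let A w := (SX_normsq (fun j => x j) (fun i j => s i j) m n w - (m * n)%:R) / r in
    tau <= 1 ->
    measurable_fun setT A /\
    `|\int[P]_w h (A w) - normal_mean h| <=
    C * ((1 + b / r) * (2 * Num.sqrt tau) + `|b / r - 1|).
Proof.
have [C1 C10 HC1] := test_function_stein.
have kx0 : 0 <= kx by apply: le_trans kx_ge1.
pose CD := (ks + 1) * kx.
have CD0 : 0 <= CD by rewrite mulr_ge0// addr_ge0// ks_ge0.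
pose C2 := L * (1 + 70 * C4); pose C3 := L * (CD + kx + 3).
have C20 : 0 <= C2 by rewrite mulr_ge0// addr_ge0// mulr_ge0.
have C30 : 0 <= C3 by rewrite mulr_ge0// !addr_ge0.
exists (C1 + C2 + C3); first by rewrite !addr_ge0.
move=> m n r m0 n0 r0 b tau A tau1.
have M0 : 0 < m%:R :> R by rewrite ltr0n.
have N0 : 0 < n%:R :> R by rewrite ltr0n.
have bsq : b ^+ 2 = 2 * (m%:R * n%:R ^+ 2).
  by rewrite sqr_sqrtr ?mulr_ge0// natrM natrX.
have b0 : 0 < b by rewrite sqrtr_gt0 mulr_gt0// ltr0n muln_gt0 m0 expn_gt0 n0.
(* The [2] is the factor of the [q_i] in [SX_normsq_decomp], so that [b * W] is the main term. *)
pose rho := 2 / b.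
have rho2 : rho ^+ 2 = 2 / (m%:R * n%:R ^+ 2).
  by rewrite /rho exprMn exprVn bsq; field; rewrite !gt_eqF.
have tau0 : 0 < tau by rewrite !addr_gt0 ?divr_gt0 ?invr_gt0.
(* This choice balances [eta] against [tau / eta]. *)
pose eta := Num.sqrt tau.
have eta0 : 0 < eta by rewrite sqrtr_gt0.
have eta2 : eta ^+ 2 = tau by rewrite sqr_sqrtr// ltW.
have eta1 : eta <= 1 by rewrite -sqrtr1 ler_sqrt.
have e0 : 0 < eta^-1 by rewrite invr_gt0.
have etau : eta^-1 * tau = eta by rewrite -eta2; field; rewrite gt_eqF.
have [W4 WE] := stein_sum_fourth m0 n0 rho2.
have [iD DE] := diagsum_sqr m n.
have [iQ QE] := sum_sqr_sub1 n.
set W := stein_sum m n rho in W4 WE.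
set D := diagsum m n in iD DE.
set Q := fun w => \sum_(j < n) (x j w ^+ 2 - 1) in iQ QE.
have mW : measurable_fun setT W by case: W4.
have mD : measurable_fun setT D.
  apply: measurable_sum => ij; apply: measurable_funM; last exact: measurable_funX.
  by apply: measurable_funB => //; exact: measurable_funX.
have mQ : measurable_fun setT Q.
  apply: measurable_sum => j; apply: measurable_funB => //; exact: measurable_funX.
have AE : A = fun w => (b * W w + D w + m%:R * Q w) / r.
  apply/funext => w; rewrite /A SX_normsq_decomp; congr ((_ + _ + _) / _).
  rewrite /W /stein_sum -mulr_sumr mulrA; congr (_ * _).
  by rewrite /rho; field; rewrite gt_eqF.
have mA : measurable_fun setT A.
  rewrite AE; apply: measurable_funM => //; apply: measurable_funD.
    by apply: measurable_funD => //; exact: measurable_funM.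
  exact: measurable_funM.
split => //.
have [iDb DB] := sqr_avg_bound mD b0 eta0 iD DE.
have b'0 : 0 < b / m%:R by rewrite divr_gt0.
have [iQb QB] := sqr_avg_bound mQ b'0 eta0 iQ QE.
have [B BE] : {B | B = b / r} by exists (b / r).
have B0 : 0 <= B by rewrite BE divr_ge0// ltW.
have [_ iW4] := W4.
have iWb : integ (fun w => 1 + W w ^+ 4).
  by apply: integrable_realD => //; exact: integrable_real_cst.
(* [|W|] is bounded by [1 + W^4], so the fourth moment already at hand is reused. *)
pose G w := L * (`|B - 1| * (1 + W w ^+ 4) + B * (`|D w| / b + `|Q w| / (b / m%:R))).
have iG1 : integ (fun w => `|D w| / b + `|Q w| / (b / m%:R)) by exact: integrable_realD.
have iG2 : integ (fun w => `|B - 1| * (1 + W w ^+ 4)) by exact: integrable_realZ.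
have iG3 : integ (fun w => B * (`|D w| / b + `|Q w| / (b / m%:R))) by exact: integrable_realZ.
have iG4 : integ (fun w => `|B - 1| * (1 + W w ^+ 4) +
    B * (`|D w| / b + `|Q w| / (b / m%:R))) by exact: integrable_realD.
have iG : integ G by exact: integrable_realZ.
have ihA := ihc mA; have ihW := ihc mW.
have bndG w : `|h (A w) - h (W w)| <= G w.
  apply: (le_trans (hL _ _)); apply: ler_wpM2l => //.
  have -> : A w - W w = (B - 1) * W w + B * (D w / b + Q w / (b / m%:R)).
    (* If [r = 0], the convention [0^-1 = 0] makes both [A w] and [B] vanish, and the identity still
       holds. *)
    rewrite AE BE; have [->|r1] := eqVneq r 0.
      by rewrite invr0 !mulr0 !mul0r; ring.
    by field; rewrite r1 !gt_eqF.
  apply: (le_trans (ler_normD _ _)); rewrite normrM [X in _ + X <= _]normrM.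
  rewrite [X in _ + X * _ <= _]ger0_norm//; apply: lerD.
    apply: ler_wpM2l => //; rewrite ler_norml; set v := W w.
    have := sqr_ge0 (v ^+ 2 - 1); have := sqr_ge0 (v - 1); have := sqr_ge0 (v + 1).
    have -> : (v ^+ 2 - 1) ^+ 2 = v ^+ 4 - 2 * v ^+ 2 + 1 by ring.
    have -> : (v - 1) ^+ 2 = v ^+ 2 - 2 * v + 1 by ring.
    have -> : (v + 1) ^+ 2 = v ^+ 2 + 2 * v + 1 by ring.
    have := sqr_ge0 (v ^+ 2); rewrite -exprM.
    by move=> ? ? ? ?; apply/andP; split; lra.
  apply: ler_wpM2l => //; apply: (le_trans (ler_normD _ _)).
  by rewrite !normrM !normfV (gtr0_norm b0) (gtr0_norm b'0).
have step1 : `|\int[P]_w h (A w) - \int[P]_w h (W w)| <= \int[P]_w G w.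
  rewrite -RintegralB//; apply: Rintegral_norm_le => //.
  exact: integrable_realB.
have GE : \int[P]_w G w <= C2 * `|B - 1| + C3 * (B * eta).
  rewrite /G RintegralZl// RintegralD// RintegralZl// RintegralZl//.
  have -> : \int[P]_w (1 + W w ^+ 4) = 1 + \int[P]_w (W w ^+ 4).
    rewrite RintegralD//; last exact: integrable_real_cst.
    by rewrite Rintegral_prob_cst.
  rewrite RintegralD//.
  rewrite /C2 /C3 -!mulrA -mulrDr; apply: ler_wpM2l => //; apply: lerD.
    by rewrite mulrC; apply: ler_wpM2r => //; rewrite lerD2l.
  rewrite [leRHS]mulrCA; apply: ler_wpM2l => //.
  apply: (le_trans (lerD DB QB)).
  (* Relative to [b^2 = 2 m n^2], the diagonal term has variance of order [1 / n] and the term in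
     [x] alone of order [m / n]; both are at most a constant times [tau]. *)
  have -> : (ks + 1) * kx * (m * n)%:R / b ^+ 2 = CD / 2 * n%:R^-1.
    by rewrite bsq natrM -/CD; field; rewrite !gt_eqF.
  have -> : (kx + 1) * n%:R / (b / m%:R) ^+ 2 = (kx + 1) / 2 * (m%:R / n%:R).
    by rewrite exprMn exprVn bsq; field; rewrite !gt_eqF.
  have tn : n%:R^-1 <= tau.
    by rewrite /tau -addrA addrCA lerDl addr_ge0 ?divr_ge0 ?invr_ge0// ltW.
  have tmn : m%:R / n%:R <= tau.
    by rewrite /tau lerDr addr_ge0 ?invr_ge0// ltW.
  have q1 : eta^-1 * (CD / 2 * n%:R^-1) <= CD / 2 * eta.
    rewrite -[X in _ <= _ * X]etau mulrCA; apply: ler_wpM2l; first by rewrite divr_ge0.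
    by apply: ler_wpM2l => //; exact: ltW.
  have q2 : eta^-1 * ((kx + 1) / 2 * (m%:R / n%:R)) <= (kx + 1) / 2 * eta.
    rewrite -[X in _ <= _ * X]etau mulrCA; apply: ler_wpM2l.
      by rewrite divr_ge0// addr_ge0.
    by apply: ler_wpM2l => //; exact: ltW.
  have p1 : 0 <= CD * eta by rewrite mulr_ge0// ltW.
  have p2 : 0 <= kx * eta by rewrite mulr_ge0// ltW.
  move: (ltW eta0) => ?.
  move: q1 q2; rewrite !mulrDl mul1r; lra.
have step2 : `|\int[P]_w h (W w) - normal_mean h| <= C1 * (2 * eta).
  apply: (le_trans (HC1 m n rho eta m0 n0 rho2 eta0 eta1)).
  apply: ler_wpM2l => //.
  have : eta^-1 * (m%:R^-1 + n%:R^-1) <= eta.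
    rewrite -[X in _ <= X]etau; apply: ler_wpM2l; first exact: ltW.
    by rewrite /tau lerDl divr_ge0// ltW.
  lra.
rewrite -BE -/eta.
have -> : \int[P]_w h (A w) - normal_mean h =
  (\int[P]_w h (A w) - \int[P]_w h (W w)) + (\int[P]_w h (W w) - normal_mean h) by ring.
apply: (le_trans (ler_normD _ _)); apply: (le_trans (lerD (le_trans step1 GE) step2)).
have n1 := normr_ge0 (B - 1); move: (ltW eta0) => eta0'.
have Be : 0 <= B * eta by rewrite mulr_ge0.
rewrite -subr_ge0 (_ : _ - _ = C1 * `|B - 1| + C3 * `|B - 1| + 2 * (C1 * (B * eta)) +
  2 * (C2 * eta) + 2 * (C2 * (B * eta)) + 2 * (C3 * eta) + C3 * (B * eta)); last by ring.
move: (mulr_ge0 C10 n1) (mulr_ge0 C30 n1) (mulr_ge0 C10 Be) (mulr_ge0 C20 eta0')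
  (mulr_ge0 C20 Be) (mulr_ge0 C30 eta0') (mulr_ge0 C30 Be); lra.
Qed.

End test_function.
End quadratic_forms.

(** * Transfer of moments between identically distributed variables *)

Section identical_distribution.
Context {d : measure_display} {T : measurableType d} {R : realType}.
Variable P : probability T R.

Lemma Rintegral_ident_dist (U V : {RV P >-> R}) (g : R -> R) :
  (forall B : set R, measurable B -> P (U @^-1` B) = P (V @^-1` B)) ->
  measurable_fun setT g ->
  P.-integrable setT (EFin \o (fun w => g (V w))) ->
  P.-integrable setT (EFin \o (fun w => g (U w))) /\
  \int[P]_w g (U w) = \int[P]_w g (V w).
Proof.
move=> UV mg iV.
have mEg : measurable_fun setT (EFin \o g) by exact/measurable_EFinP.
have mab : measurable_fun setT (fun y => `|(EFin \o g) y|%E).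
  exact: measurableT_comp.
have iU : P.-integrable setT (EFin \o (fun w => g (U w))).
  apply/integrableP; split.
    by apply/measurable_EFinP; exact: measurableT_comp.
  move/integrableP : iV => [_].
  have := @ge0_integral_distribution _ _ _ _ _ P V _ mab (fun y => abse_ge0 _).
  have := @ge0_integral_distribution _ _ _ _ _ P U _ mab (fun y => abse_ge0 _).
  rewrite /= => <- <-.
  rewrite (eq_measure_integral (distribution P U))// => B mB _.
  exact/esym/UV.
split=> //; rewrite /Rintegral; congr fine.
have E (W : {RV P >-> R}) : P.-integrable setT (EFin \o (fun w => g (W w))) ->
    (\int[P]_w (g (W w))%:E = \int[distribution P W]_y (EFin \o g) y)%E.
  by move=> iW; rewrite integral_distribution.
rewrite !E//; apply: eq_measure_integral => B mB _.
exact: UV.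
Qed.

Lemma Rintegral_indicator (A : set T) : measurable A ->
  \int[P]_w (\1_A w) = fine (P A).
Proof. by move=> mA; rewrite /Rintegral integral_indic// setIT. Qed.

End identical_distribution.

(** * Piecewise linear test functions *)

Section ramp_function.
Context {R : realType}.
Local Notation mu := (@lebesgue_measure R).
Local Notation phi := (normal_pdf (0 : R) 1).

Definition ramp (t del y : R) : R := Num.max 0 (Num.min 1 (1 - (y - t) / del)).

Variables (t del : R).
Hypothesis del0 : 0 < del.

Lemma ramp01 y : 0 <= ramp t del y <= 1.
Proof. by rewrite /ramp le_max lexx/= ge_max ler01 ge_min lexx. Qed.

Lemma ramp_eq1 y : y <= t -> ramp t del y = 1.
Proof.
move=> yt; rewrite /ramp min_l ?max_r// lerBrDr addrC -lerBrDr subrr.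
by rewrite pmulr_lle0 ?invr_gt0// subr_le0.
Qed.

Lemma ramp_eq0 y : t + del <= y -> ramp t del y = 0.
Proof.
move=> yt; have h : 1 - (y - t) / del <= 0.
  by rewrite subr_le0 ler_pdivlMr// mul1r lerBrDl.
by rewrite /ramp min_r ?max_l// (le_trans h).
Qed.

(** Clamping to [[0, 1]] is 1-Lipschitz; the nine cases locate the two unclamped values. *)
Lemma ramp_lip y y' : `|ramp t del y - ramp t del y'| <= del^-1 * `|y - y'|.
Proof.
have -> : del^-1 * `|y - y'| = `|(1 - (y - t) / del) - (1 - (y' - t) / del)|.
  have -> : (1 - (y - t) / del) - (1 - (y' - t) / del) = - (del^-1 * (y - y')) by ring.
  by rewrite normrN normrM ger0_norm// invr_ge0 ltW.
rewrite /ramp; set a := 1 - (y - t) / del; set b := 1 - _.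
have h1 := ler_norm (a - b); have h2 := ler_norm (b - a); rewrite distrC in h2.
have clamp (u : R) : [\/ Num.max 0 (Num.min 1 u) = 0 /\ u <= 0,
    [/\ Num.max 0 (Num.min 1 u) = u, 0 <= u & u <= 1] |
    Num.max 0 (Num.min 1 u) = 1 /\ 1 <= u].
  have [u0|u0] := leP u 0.
    by apply: Or31; rewrite min_r ?max_l// (le_trans u0).
  have [u1|/ltW u1] := leP u 1.
    by apply: Or32; rewrite max_r// ltW.
  by apply: Or33; rewrite max_r.
rewrite ler_norml.
by case: (clamp a) => [[-> ?]|[-> ? ?]|[-> ?]];
   case: (clamp b) => [[-> ?]|[-> ? ?]|[-> ?]]; apply/andP; split; lra.
Qed.

Lemma measurable_ramp : measurable_fun setT (ramp t del).
Proof.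
apply: measurable_maxr; first exact: measurable_cst.
apply: measurable_minr; first exact: measurable_cst.
apply: measurable_funB; first exact: measurable_cst.
apply: measurable_funM; last exact: measurable_cst.
by apply: measurable_funB; [exact: measurable_id|exact: measurable_cst].
Qed.

End ramp_function.

(** * The Gaussian distribution function against ramps *)

Section normal_cdf.
Context {R : realType}.
Local Notation mu := (@lebesgue_measure R).
Local Notation phi := (normal_pdf (0 : R) 1).
Variables (t del : R).
Hypothesis del0 : 0 < del.

Definition normal_cdf (u : R) : R := \int[mu]_(y in `]-oo, u]) phi y.

Lemma normal_cdfE u : normal_prob 0 1 `]-oo, u] = (normal_cdf u)%:E.
Proof.
rewrite /normal_cdf /Rintegral fineK//.
by apply: (@integrable_fin_num _ _ _ mu _ _ (EFin \o phi)) => //; exact: integrable_phi.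
Qed.

(** The density is at most its peak. This continuity of the limit law is what closes the gap of
    width [del] left by the ramps. *)
Lemma normal_cdf_incr : normal_cdf (t + del) - normal_cdf t <= normal_peak 1 * del.
Proof.
have := @Rintegral_itvB R phi -oo%O (BRight (t + del)) t.
rewrite -/(normal_cdf (t + del)) -/(normal_cdf t) => ->.
- apply: (@le_trans _ _ (\int[mu]_(y in `]t, (t + del)]) (normal_peak 1))).
    apply: le_Rintegral => //.
    + exact: integrable_phi.
    + apply/integrableP; split; first by apply/measurable_EFinP; exact: measurable_cst.
      rewrite /= integral_cst//= lebesgue_measure_itv /= lte_fin ltrDl del0.
      by rewrite -EFinD -EFinM ltry.
    + by move=> y _; apply: normal_pdf_ub; exact: oner_neq0.
  rewrite /Rintegral integral_cst//= lebesgue_measure_itv /= lte_fin ltrDl del0.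
  by rewrite -EFinD -EFinM /= [t + del]addrC addrK.
- exact: integrable_phi.
- by [].
- by rewrite bnd_simp lerDl ltW.
Qed.

Let h := ramp t del.

Let ih (A : set R) : measurable A -> mu.-integrable A (EFin \o (fun y => h y * phi y)).
Proof.
move=> mA; apply: le_integrable (integrable_phi mA) => //.
  apply/measurable_EFinP/measurable_funTS; apply: measurable_funM.
    exact: measurable_ramp.
  exact: measurable_normal_pdf.
move=> y _ /=; rewrite lee_fin normrM ler_piMl//.
by case/andP: (ramp01 t del y) => ? ?; rewrite ger0_norm.
Qed.

Lemma normal_mean_ramp :
  normal_cdf t <= normal_mean (ramp t del) <= normal_cdf (t + del).
Proof.
apply/andP; split.
  have := @Rintegral_itvB R (fun y => h y * phi y) -oo%O +oo%O t.
  rewrite set_itvNyy => /(_ (ih measurableT) isT isT) E.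
  have -> : normal_cdf t = \int[mu]_(y in `]-oo, t]) (h y * phi y).
    apply: eq_Rintegral => y; rewrite inE /= in_itv /= => yt.
    by rewrite /h ramp_eq1// mul1r.
  rewrite -subr_ge0 E; apply: Rintegral_ge0 => y _.
  by rewrite mulr_ge0 ?normal_pdf_ge0//; case/andP: (ramp01 t del y).
have := @Rintegral_itvB R (fun y => h y * phi y) -oo%O +oo%O (t + del).
rewrite set_itvNyy => /(_ (ih measurableT) isT isT).
rewrite [X in _ = X -> _](_ : _ = 0); last first.
  under eq_Rintegral => y.
    rewrite inE /= in_itv /= andbT => /ltW ty.
    rewrite /h ramp_eq0// mul0r; over.
  by rewrite /Rintegral integral0.
move/eqP; rewrite subr_eq0 => /eqP; rewrite /normal_mean => ->.
apply: le_Rintegral => //.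
- exact: ih.
- exact: integrable_phi.
- by move=> y _; rewrite ler_piMl ?normal_pdf_ge0//; case/andP: (ramp01 t del y).
Qed.

End normal_cdf.

(** * Distribution functions squeezed between ramp expectations *)

Section cdf_sandwich.
Context {d : measure_display} {T : measurableType d} {R : realType}.
Variable P : probability T R.

Lemma cdf_ramp (A : T -> R) (t del : R) : measurable_fun setT A -> 0 < del ->
  \int[P]_w ramp (t - del) del (A w) <= fine (P [set w | A w <= t]) <=
  \int[P]_w ramp t del (A w).
Proof.
move=> mA del0.
have mS : measurable [set w | A w <= t].
  rewrite (_ : [set w | _] = setT `&` A @^-1` `]-oo, t]).
    by apply: mA => //; exact: measurable_itv.
  by apply/seteqP; split => w /=; rewrite in_itv /=; [|case].
have ir t' : P.-integrable setT (EFin \o (fun w => ramp t' del (A w))).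
  apply: (integrable_le_norm _ (integrable_real_cst P 1)).
    by apply: measurableT_comp => //; exact: measurable_ramp.
  by move=> w; case/andP: (ramp01 t' del (A w)) => ? ?; rewrite ger0_norm.
have iI : P.-integrable setT (EFin \o (fun w => \1_([set w | A w <= t]) w : R)).
  exact: integrable_indic.
rewrite -Rintegral_indicator//; apply/andP; split; apply: le_Rintegral => //.
- move=> w _; rewrite indicE; have [wt|wt] := leP (A w) t.
    by rewrite mem_set//; case/andP: (ramp01 (t - del) del (A w)).
  by rewrite ramp_eq0 ?ler0n// subrK ltW.
- move=> w _; rewrite indicE; have [wt|wt] := leP (A w) t.
    by rewrite ramp_eq1// mem_set.
  rewrite memNset/=; last by apply/negP; rewrite -ltNge.
  by case/andP: (ramp01 t del (A w)).
Qed.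

End cdf_sandwich.

(** * Limits of the error terms along the sequences of dimensions *)

Section asymptotics.
Context {R : realType}.
Variables (mk nk : nat -> nat).
Hypothesis mkoo : (fun k => (mk k)%:R : R) @ \oo --> +oo.
Hypothesis nkoo : (fun k => (nk k)%:R : R) @ \oo --> +oo.
Hypothesis mnk0 : (fun k => (mk k)%:R / (nk k)%:R : R) @ \oo --> (0 : R).

Let inv_cvg0 (u : nat -> nat) : ((fun k => (u k)%:R : R) @ \oo --> +oo) ->
  (fun k => (u k)%:R^-1 : R) @ \oo --> (0 : R).
Proof. by move=> uoo; apply/gtr0_cvgV0 => //; exact: cvgry_gt. Qed.

Definition small_scale (k : nat) : R :=
  (mk k)%:R^-1 + (nk k)%:R^-1 + (mk k)%:R / (nk k)%:R.

Lemma small_scale_cvg : small_scale k @[k --> \oo] --> (0 : R).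
Proof.
rewrite -[X in _ --> X](_ : 0 + 0 + 0 = 0); last by rewrite !addr0.
by apply: cvgD => //; apply: cvgD; exact: inv_cvg0.
Qed.

(** The quotient [b / r] of [test_function_error] after cancelling [2 m n^2]; it depends on [m / n]
    and [1 / n] only. *)
Definition denom_ratio (a xi : R) (k : nat) : R :=
  (Num.sqrt (1 + a / 2 * ((mk k)%:R / (nk k)%:R) + xi / 2 * (nk k)%:R^-1))^-1.

Lemma denom_ratio_cvg a xi : denom_ratio a xi k @[k --> \oo] --> (1 : R).
Proof.
rewrite -[X in _ --> X]invr1; apply: cvgV; first exact: oner_neq0.
rewrite -[X in _ --> X](@sqrtr1 R).
apply: (@continuous_cvg _ _ _ _ _ _ Num.sqrt); first exact: sqrt_continuous.
rewrite -[X in _ --> X](_ : 1 + a / 2 * 0 + xi / 2 * 0 = 1); last first.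
  by rewrite !mulr0 !addr0.
apply: cvgD; last by apply: cvgM; [exact: cvg_cst|exact: inv_cvg0].
by apply: cvgD; [exact: cvg_cst|apply: cvgM => //; exact: cvg_cst].
Qed.

(** Valid for any sign of the radicand: the square root is multiplicative as soon as the factor
    [2 m n^2] is nonnegative, and zero roots are covered by [0^-1 = 0]. *)
Lemma denom_ratioE a xi k : (0 < mk k)%N -> (0 < nk k)%N ->
  Num.sqrt (2 * (mk k * nk k ^ 2)%:R) /
  Num.sqrt (a * (mk k ^ 2 * nk k)%:R + 2 * (mk k * nk k ^ 2)%:R
            + xi * (mk k * nk k)%:R) = denom_ratio a xi k.
Proof.
move=> m0 n0.
have M0 : 0 < (mk k)%:R :> R by rewrite ltr0n.
have N0 : 0 < (nk k)%:R :> R by rewrite ltr0n.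
have -> : (mk k * nk k ^ 2)%:R = (mk k)%:R * (nk k)%:R ^+ 2 :> R by rewrite natrM natrX.
have -> : (mk k ^ 2 * nk k)%:R = (mk k)%:R ^+ 2 * (nk k)%:R :> R by rewrite natrM natrX.
have -> : (mk k * nk k)%:R = (mk k)%:R * (nk k)%:R :> R by rewrite natrM.
set b2 := 2 * _; set v := 1 + a / 2 * ((mk k)%:R / (nk k)%:R) + xi / 2 * (nk k)%:R^-1.
have b20 : 0 < b2 by rewrite !mulr_gt0// exprn_gt0.
have -> : a * ((mk k)%:R ^+ 2 * (nk k)%:R) + b2 + xi * ((mk k)%:R * (nk k)%:R) = b2 * v.
  by rewrite /b2 /v; field; rewrite gt_eqF.
rewrite sqrtrM ?ltW// invfM mulrA divff ?mul1r//.
by rewrite gt_eqF// sqrtr_gt0.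
Qed.

Lemma error_cvg (a xi C : R) :
  C * ((1 + denom_ratio a xi k) * (2 * Num.sqrt (small_scale k)) +
    `|denom_ratio a xi k - 1|) @[k --> \oo] --> (0 : R).
Proof.
rewrite -[X in _ --> X](_ : C * ((1 + 1) * (2 * Num.sqrt 0) + `|1 - 1|) = 0); last first.
  by rewrite sqrtr0 subrr normr0 !mulr0 addr0 mulr0.
apply: cvgM; first exact: cvg_cst.
have dr := denom_ratio_cvg a xi.
apply: cvgD.
  apply: cvgM; first by apply: cvgD => //; exact: cvg_cst.
  apply: cvgM; first exact: cvg_cst.
  apply: (@continuous_cvg _ _ _ _ _ _ Num.sqrt); first exact: sqrt_continuous.
  exact: small_scale_cvg.
by apply: cvg_norm; apply: cvgB => //; exact: cvg_cst.
Qed.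

End asymptotics.

Theorem theorem2 (R : realType) (d : measure_display) (T : measurableType d)
  (P : probability T R)
  (x : nat -> {RV P >-> R}) (s : nat -> nat -> {RV P >-> R})
  (sigma c : R) :
  (* all entries of X and S are mutually independent *)
  mutually_independent P (joint_family (fun j => x j) (fun a b => s a b)) ->
  (* entries of X identically distributed *)
  (forall j (B : set R), measurable B -> P (x j @^-1` B) = P (x 0%N @^-1` B)) ->
  (* entries of S identically distributed *)
  (forall a b (B : set R), measurable B ->
     P (s a b @^-1` B) = P (s 0%N 0%N @^-1` B)) ->
  (* moments of x_1 *)
  ('E_P[x 0%N] = 0)%E ->
  ('E_P[(fun w => x 0%N w ^+ 2)%R] = 1)%E ->
  ('E_P[(fun w => x 0%N w ^+ 4)%R] = (1 + sigma ^+ 2)%:E)%E ->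
  0 <= sigma ->
  (* moments of S_{1,1} *)
  ('E_P[s 0%N 0%N] = 0)%E ->
  ('E_P[(fun w => s 0%N 0%N w ^+ 2)%R] = 1)%E ->
  ('E_P[(fun w => s 0%N 0%N w ^+ 4)%R] < c%:E)%E ->
  let xi := (fine 'E_P[(fun w => s 0%N 0%N w ^+ 4)%R] - 1) * (1 + sigma ^+ 2) - 2 in
  forall (mk nk : nat -> nat),
    ((fun k => (mk k)%:R : R) @ \oo --> +oo) ->
    ((fun k => (nk k)%:R : R) @ \oo --> +oo) ->
    ((fun k => (mk k)%:R / (nk k)%:R : R) @ \oo --> (0 : R)) ->
    forall t : R,
      (fun k => P [set w | Amn (fun j => x j) (fun a b => s a b) sigma xi
                              (mk k) (nk k) w <= t])
        @ \oo --> normal_prob 0 1 `]-oo, t].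
Proof.
move=> indep idx ids _ Ex2 Ex4 _ Es1 Es2 Es4 xi mk nk mkoo nkoo mnk0 t.
have indepZ : mutually_independent P (fun i => entries x s i : T -> R).
  by rewrite (_ : (fun i => _) = joint_family (fun j => x j) (fun a b => s a b))//;
    apply/funext => -[].
have int4 (V : {RV P >-> R}) : ('E_P[(fun w => V w ^+ 4)%R] < +oo)%E ->
    P.-integrable setT (EFin \o (fun w => V w ^+ 4)).
  move=> Vk; apply/integrableP; split.
    by apply/measurable_EFinP; exact: measurable_funX.
  move: Vk; rewrite unlock; apply: le_lt_trans; rewrite le_eqVlt; apply/orP; left.
  apply/eqP; apply: eq_integral => w _ /=; rewrite ger0_norm//.
  exact: (exprn_even_ge0 _ (isT : ~~ odd 4)).
have x04 : P.-integrable setT (EFin \o (fun w => x 0%N w ^+ 4)).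
  by apply: int4 => //; rewrite Ex4 ltry.
have s04 : P.-integrable setT (EFin \o (fun w => s 0%N 0%N w ^+ 4)).
  by apply: int4 => //; rewrite (lt_trans Es4)// ltry.
have x0L : fourth_integrable P (x 0%N) by split.
have s0L : fourth_integrable P (s 0%N 0%N) by split.
pose kx := 1 + sigma ^+ 2; pose ks := fine 'E_P[(fun w => s 0%N 0%N w ^+ 4)].
have mX (n : nat) : measurable_fun setT (fun v : R => v ^+ n) by exact: exprn_measurable.
have hx4 j := @Rintegral_ident_dist _ _ _ P (x j) (x 0%N) _ (idx j) (mX 4%N) x04.
have hx2 j := @Rintegral_ident_dist _ _ _ P (x j) (x 0%N) _ (idx j) (mX 2%N)
  (fourth_integrable_sqr x0L).
have hs4 i j := @Rintegral_ident_dist _ _ _ P (s i j) (s 0%N 0%N) _ (ids i j) (mX 4%N) s04.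
have hs2 i j := @Rintegral_ident_dist _ _ _ P (s i j) (s 0%N 0%N) _ (ids i j) (mX 2%N)
  (fourth_integrable_sqr s0L).
have hs1 i j := @Rintegral_ident_dist _ _ _ P (s i j) (s 0%N 0%N) idfun (ids i j)
  (@measurable_id _ _ setT) (fourth_integrable_integrable s0L).
have x4 j : P.-integrable setT (EFin \o (fun w => x j w ^+ 4)) by case: (hx4 j).
have s4 i j : P.-integrable setT (EFin \o (fun w => s i j w ^+ 4)) by case: (hs4 i j).
have ex4 j : \int[P]_w (x j w ^+ 4) = kx.
  by case: (hx4 j) => _ ->; rewrite /Rintegral; move: Ex4; rewrite unlock => ->.
have ex2 j : \int[P]_w (x j w ^+ 2) = 1.
  by case: (hx2 j) => _ ->; rewrite /Rintegral; move: Ex2; rewrite unlock => ->.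
have es4 i j : \int[P]_w (s i j w ^+ 4) = ks.
  by case: (hs4 i j) => _ ->; rewrite /Rintegral /ks unlock.
have es2 i j : \int[P]_w (s i j w ^+ 2) = 1.
  by case: (hs2 i j) => _ ->; rewrite /Rintegral; move: Es2; rewrite unlock => ->.
have es1 i j : \int[P]_w (s i j w) = 0.
  by case: (hs1 i j) => _ /= ->; rewrite /Rintegral; move: Es1; rewrite unlock => ->.
pose A k := Amn (fun j => x j) (fun a b => s a b) sigma xi (mk k) (nk k).
have cvg_ramp (u del e : R) : 0 < del -> 0 < e -> \forall k \near \oo,
    measurable_fun setT (A k) /\
    `|\int[P]_w ramp u del (A k w) - normal_mean (ramp u del)| <= e.
  move=> del0 e0.
  have di0 : 0 <= del^-1 by rewrite invr_ge0 ltW.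
  have [C C0 HC] := test_function_error indepZ x4 s4 ex2 ex4 es1 es2 es4 di0
    (ramp01 u del) (ramp_lip u del0) (measurable_ramp u del).
  have errc := @error_cvg R mk nk mkoo nkoo mnk0 (sigma ^+ 2) xi C.
  near=> k.
  have m0 : (0 < mk k)%N.
    by rewrite -(ltr0n R); near: k; exact: cvgry_gt.
  have n0 : (0 < nk k)%N.
    by rewrite -(ltr0n R); near: k; exact: cvgry_gt.
  have tau1 : @small_scale R mk nk k <= 1.
    by near: k; apply: cvgr_le (small_scale_cvg mkoo nkoo mnk0) _ _.
  have [mA bA] := HC (mk k) (nk k)
    (Num.sqrt (sigma ^+ 2 * (mk k ^ 2 * nk k)%:R + 2 * (mk k * nk k ^ 2)%:R
      + xi * (mk k * nk k)%:R)) m0 n0 (sqrtr_ge0 _) tau1.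
  split; first exact: mA.
  apply: (le_trans bA).
  rewrite (denom_ratioE (sigma ^+ 2) xi m0 n0).
  by near: k; apply: cvgr_le errc _ _.
rewrite normal_cdfE; apply: cvg_EFin.
  near=> k; apply: fin_num_measure.
  (* Only measurability of [A k] is wanted; the ramp and the tolerance [1] are arbitrary. *)
  have [mA _] : measurable_fun setT (A k) /\
      `|\int[P]_w ramp t 1 (A k w) - normal_mean (ramp t 1)| <= 1.
    by near: k; exact: cvg_ramp.
  rewrite (_ : [set w | _] = setT `&` A k @^-1` `]-oo, t]).
    by apply: mA => //; exact: measurable_itv.
  by apply/seteqP; split => w /=; rewrite in_itv /=; [|case].
apply/cvgrPdist_le => e e0.
have p0 : 0 < @normal_peak R 1 by apply: normal_peak_gt0; exact: oner_neq0.
(* Over a width [del] the normal distribution function moves by at most [e / 2]; the other half of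
   [e] is for the test functions. *)
pose del := e / 2 / normal_peak 1.
have del0 : 0 < del by rewrite !divr_gt0.
have pdel : normal_peak 1 * del = e / 2 by rewrite /del mulrC divfK// gt_eqF.
have e20 : 0 < e / 2 by rewrite divr_gt0.
near=> k.
have [mA up] : measurable_fun setT (A k) /\
    `|\int[P]_w ramp t del (A k w) - normal_mean (ramp t del)| <= e / 2.
  by near: k; exact: cvg_ramp.
have [_ lo] : measurable_fun setT (A k) /\
    `|\int[P]_w ramp (t - del) del (A k w) - normal_mean (ramp (t - del) del)| <= e / 2.
  by near: k; exact: cvg_ramp.
have /andP[c1 c2] := cdf_ramp P t mA del0.
have /andP[n1 n2] := normal_mean_ramp t del0.
have /andP[n3 n4] := normal_mean_ramp (t - del) del0.
have i1 := normal_cdf_incr t del0.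
have i2 := normal_cdf_incr (t - del) del0.
rewrite subrK in i2 n4.
rewrite pdel in i1 i2.
move: up lo; rewrite !ler_norml => /andP[u1 u2] /andP[l1 l2].
rewrite /= -/(A k); apply/andP; split; lra.
Unshelve. all: by end_near. Qed.
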